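(* Let $k \geq 1$ be a real number, let $q$ be an even natural number, and write $\Lambda = 6 + 25 \log q$ and \[ s = 2^{5 + (1 + 120 \cdot 2^{\lceil 600 q k \Lambda \rceil})(\lceil \log k \rceil + 1)}. \] Then for every finite, non-empty set $A$ of integers, there exist pairwise disjoint sets $B, C$ such that $A = B \cup C$ and \[ E_{q/2}(B) \ll_{k,q} |B|^{q - q/5} \quad \text{and} \quad M_{s}(C) \ll_{s} |C|^{2s - k}. \]
   Context: For a natural number $t$ and a finite set $X$ of real numbers, the $t$-fold additive energy is $E_t(X) = |\{(x_1,\dots,x_{2t}) \in X^{2t} : x_1 + \dots + x_t = x_{t+1} + \dots + x_{2t}\}|$ and the $t$-fold multiplicative energy is $M_t(X) = |\{(x_1,\dots,x_{2t}) \in X^{2t} : x_1 \cdots x_t = x_{t+1} \cdots x_{2t}\}|$. The notation $X \ll_z Y$ means $|X| \leq C_z |Y|$ for a positive constant $C_z$ depending only on the parameter(s) $z$. *)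

(* Defs.v *)
From HB Require Import structures.
From mathcomp Require Import all_boot all_order all_algebra.
From mathcomp Require Import finmap.
From mathcomp Require Import all_classical all_reals all_analysis.
Set Implicit Arguments. Unset Strict Implicit. Unset Printing Implicit Defensive.
Import Order.TTheory GRing.Theory Num.Theory.
Local Open Scope fset_scope.
Local Open Scope ring_scope.

Definition add_energy (t : nat) (X : {fset int}) : nat :=
  #|[set p : {ffun 'I_t -> X} * {ffun 'I_t -> X} |
      \sum_(i < t) val (p.1 i) == \sum_(i < t) val (p.2 i)]|.

Definition mul_energy (t : nat) (X : {fset int}) : nat :=
  #|[set p : {ffun 'I_t -> X} * {ffun 'I_t -> X} |
      \prod_(i < t) val (p.1 i) == \prod_(i < t) val (p.2 i)]|.

(* Main.v *)
(** Encode multiplication by p-adic valuations and induct on the primes, splitting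
    a set A into the fibres A_j of one valuation.  Two quantities are tracked.

    - The 2s-th root N(A) of the s-fold multiplicative energy.  By Hoelder, N(A)
      is at most the L^{2s} norm of the one-variable trigonometric polynomial
      with coefficients N(A_j).
    - A weight psi(A), the larger of max_j psi(A_j) and (1/H) sum_j psi(A_j).
      Unfolding the recursion, A contains for each D a subset whose elements are
      determined by D adaptive valuation queries and whose size is at least
      psi(A) - H^{-D} |A|.

    The heart of the argument is the one-variable inequality which propagates
    N(A) <= psi(A)^al |A|^(1-al), with al = kap/(2s), as soon as s is large in
    terms of kap and H.  Hence if the multiplicative energy of A exceeds
    |A|^{2s-k}, then psi(A) > |A|^{3/4}, and A has a large subset A' of small query
    complexity.  Such a set has small additive energy: in a relation
    a_1 + ... + a_t = a_{t+1} + ... + a_{2t} the smallest p-adic valuation occurs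
    at least twice, so each query costs a factor (2t)^2.  Removing such subsets
    greedily, and adding up their energies by the triangle inequality in L^{2t},
    produces B; what remains is C, and 0 is put into B. *)
Require Import Defs.
From HB Require Import structures.
From mathcomp Require Import all_boot all_order all_algebra.
From mathcomp Require Import cyclic separable cyclotomic complex.
From mathcomp Require Import finmap.
From mathcomp Require Import all_classical all_reals all_analysis.
From mathcomp Require Import zify ring lra.
Set Implicit Arguments. Unset Strict Implicit. Unset Printing Implicit Defensive.
Import Order.TTheory GRing.Theory Num.Theory.
Local Open Scope ring_scope.

(** * Tuples and Fourier analysis *)

(** Both sides of a relation share one index set. The Boolean records the side and hence the sign,
    so that a relation becomes the vanishing of a signed sum. *)
Definition slot (t : nat) : finType := (bool * 'I_t)%type.
Definition slot_sign (b : bool) : int := if b then 1 else -1.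

Lemma card_slot t : #|slot t| = (2 * t)%N.
Proof. by rewrite card_prod card_bool card_ord. Qed.

Lemma sum_slot_sign t (z : int) : \sum_(k : slot t) slot_sign k.1 * z = 0.
Proof.
rewrite -(pair_bigA _ (fun b _ => slot_sign b * z)) /= big_bool /=.
by rewrite !sumr_const -mulrnDl -mulrDl addrN mul0r mul0rn.
Qed.

(** The map [phi] is vector-valued so as to serve two cases: a single coordinate [num] for sums of
    integers, and the vector of p-adic valuations for products. *)
Definition balanced (T I : finType) (phi : T -> I -> int) (t : nat)
    (p : {ffun slot t -> T}) : bool :=
  [forall i, \sum_k slot_sign k.1 * phi (p k) i == 0].

(** The multilinear form whose diagonal is the energy. Separate weights at each slot allow a sum of
    functions to be expanded and each term estimated by Hoelder. *)
Definition wsum (R : realDomainType) (T I : finType) (phi : T -> I -> int)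
    (t : nat) (c : slot t -> T -> R) : R :=
  \sum_(p | balanced phi p) \prod_k c k (p k).

Definition energy (R : realDomainType) (T I : finType) (phi : T -> I -> int)
    (t : nat) (c : T -> R) : R :=
  wsum phi (fun _ : slot t => c).

Lemma prim_root_exists (F : numClosedFieldType) n :
  (n > 0)%N -> exists z : F, n.-primitive_root z.
Proof.
move=> n_gt0; have [rs rsE] := closed_field_poly_normal ('X^n - 1 : {poly F}).
rewrite (eqP (monicXnsubC 1 n_gt0)) scale1r in rsE.
have /hasP[z _ zP] : has n.-primitive_root rs; last by exists z.
apply: has_prim_root => //.
- by apply/allP => z; rewrite -root_prod_XsubC -rsE.
- by rewrite -separable_prod_XsubC -rsE separable_Xn_sub_1 // pnatr_eq0 -lt0n.
- by rewrite -ltnS -(size_prod_XsubC rs id) -rsE size_XnsubC.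
Qed.

(** A geometric sum. The bound on [z] makes vanishing modulo [n] the same as vanishing, so integer
    relations are detected exactly. *)
Lemma sum_prim_root_exp (F : fieldType) n (w : F) (z : int) :
  n.-primitive_root w -> (`|z| < n)%N ->
  \sum_(x < n) w ^ (z * x%:Z) = (if z == 0 then n%:R else 0).
Proof.
move=> wp zn; have n_gt0 := prim_order_gt0 wp.
have w0 : w != 0.
  apply/eqP => w0; have := prim_expr_order wp.
  by rewrite w0 expr0n (gtn_eqF n_gt0) => /esym/eqP; rewrite oner_eq0.
case: eqP => [->|/eqP z0].
  by under eq_bigr do rewrite mul0r expr0z; rewrite sumr_const card_ord.
have wz1 : w ^ z != 1.
  have: w ^+ `|z| != 1.
    by rewrite -(prim_order_dvd wp) gtnNdvd // absz_gt0.
  case: z {zn z0} => m //= h.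
  by rewrite NegzE -exprnN invr_eq1.
have: (w ^ z - 1) * (\sum_(x < n) w ^ (z * x%:Z)) = 0.
  under eq_bigr do rewrite -exprz_exp -exprnP.
  rewrite -subrX1 exprnP exprz_exp mulrC -exprz_exp -exprnP (prim_expr_order wp).
  by rewrite exp1rz subrr.
by move/eqP; rewrite mulf_eq0 subr_eq0 (negPf wz1) => /eqP.
Qed.

Section Fourier.
Variables (R : rcfType) (T I : finType) (phi : T -> I -> int).
Local Notation C := R[i]%C.

Lemma normcR_Re (z : C) : (complex.Re `|z|)%:C%C = `|z|.
Proof. by rewrite RRe_real // ger0_real. Qed.

(* [G c x] is |sum_a c_a chi_x(a)|, where [x] runs through the characters of
   (Z/N)^I, and N is so large that no balance is lost modulo N. *)
Lemma fourier_model (tmax : nat) :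
  exists (Om : finType) (x0 : Om) (G : (T -> R) -> Om -> R),
  [/\ forall c x, 0 <= G c x,
      forall t (c : slot t -> T -> R), (t <= tmax)%N ->
        wsum phi c * #|Om|%:R <= \sum_x \prod_k G (c k) x,
      forall t (c : T -> R), (t <= tmax)%N ->
        energy phi t c * #|Om|%:R = \sum_x G c x ^+ (2 * t)
    & forall c x, (forall a, 0 <= c a) -> G c x <= \sum_a c a].
Proof.
pose mx := (\sum_(a : T) \sum_(i : I) `|phi a i|)%N.
pose N := (2 * tmax * mx).+1.
have [w wp] : exists w : C, N.-primitive_root w by exact: prim_root_exists.
have w0 : w != 0.
  apply/eqP => w0; have := prim_expr_order wp.
  by rewrite w0 expr0n => /esym/eqP; rewrite oner_eq0.
have wn1 (z : int) : `|w ^ z| = 1.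
  have w1 : `|w| = 1.
    have /(congr1 Num.norm) := prim_expr_order wp.
    by rewrite normrX normr1 => /eqP; rewrite pexpr_eq1 // => /eqP.
  case: z => m; rewrite ?NegzE -?exprnN -?exprnP ?normrV ?unitfE ?expf_neq0 //.
    by rewrite normrX w1 expr1n.
  by rewrite normrX w1 expr1n invr1.
have wconj (z : int) : (w ^ z)^* = w ^ (- z) :> C.
  have h := wn1 z; apply: (mulfI (expfz_neq0 z w0)).
  by rewrite -expfzDr // subrr expr0z -normCK h expr1n.
pose Om : finType := {ffun I -> 'I_N}.
pose chi (b : bool) (x : Om) (a : T) : C :=
  \prod_i w ^ (slot_sign b * phi a i * (x i)%:Z).
pose F (c : T -> R) b x : C := \sum_a (c a)%:C%C * chi b x a.
have chiconj b x a : (chi b x a)^* = chi (~~ b) x a.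
  rewrite /chi rmorph_prod; apply: eq_bigr => i _. apply: etrans (wconj _) _.
  by congr (_ ^ _); case: b; rewrite /slot_sign /=; ring.
have chi1 b x a : `|chi b x a| = 1.
  by rewrite /chi normr_prod big1 // => i _; rewrite wn1.
have Fconj c b x : (F c b x)^* = F c (~~ b) x.
  rewrite /F rmorph_sum; apply: eq_bigr => a _; rewrite rmorphM /= chiconj.
  congr (_ * _); exact: conjc_real.
have FN c b x : `|F c b x| = `|F c true x|.
  by case: b => //; rewrite -[false]/(~~ true) -Fconj norm_conjC.
pose G c x := complex.Re `|F c true x|.
have GE c x : (G c x)%:C%C = `|F c true x| by rewrite /G normcR_Re.
have G0 c x : 0 <= G c x by rewrite -ler0c GE.
(* Orthogonality of characters: the sum over [x] factors over the coordinates [i], and each factor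
   tests one coordinate of the balance condition. *)
have orth t (p : {ffun slot t -> T}) : (t <= tmax)%N ->
    \sum_(x : Om) \prod_k chi k.1 x (p k) =
    if balanced phi p then (#|Om|)%:R else 0.
  move=> le_t; pose z i := \sum_k slot_sign k.1 * phi (p k) i.
  have -> : \sum_(x : Om) \prod_k chi k.1 x (p k) =
      \prod_i \sum_(y < N) w ^ (z i * y%:Z).
    rewrite bigA_distr_bigA; apply: eq_bigr => x _.
    rewrite /chi exchange_big /=; apply: eq_bigr => i _.
    rewrite /z mulr_suml.
    by elim/big_ind2: _ => [|u1 u2 v1 v2 -> ->|] //; rewrite ?expr0z // expfzDr.
  have zN i : (`|z i| < N)%N.
    rewrite ltnS; have h a j : (`|phi a j| <= mx)%N.
      rewrite /mx (bigD1 a) //= (bigD1 j) //= -addnA.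
      exact: leq_addr.
    rewrite -lez_nat abszE; apply: le_trans (ler_norm_sum _ _ _) _.
    apply: (@le_trans _ _ (\sum_(k : slot t) mx%:Z)).
      apply: ler_sum => k _; rewrite normrM -abszE.
      by case: k.1; rewrite ?mul1r ?mulN1r ?normrN ?normr1 ?mul1r lez_nat h.
    rewrite sumr_const card_slot -mulr_natl natz -PoszM lez_nat.
    by rewrite leq_mul2r leq_mul2l le_t !orbT.
  under eq_bigr => i _ do rewrite (sum_prim_root_exp wp (zN i)).
  case: ifP => [/forallP bal|/negbT].
    under eq_bigr => i _ do rewrite bal.
    by rewrite prodr_const card_ffun card_ord natrX.
  rewrite negb_forall => /existsP[i nz].
  by rewrite (bigD1 i) //= (negPf nz) mul0r.
have key t (c : slot t -> T -> R) : (t <= tmax)%N ->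
    (wsum phi c * #|Om|%:R)%:C%C = \sum_x \prod_k F (c k) k.1 x.
  move=> le_t; rewrite /F.
  under eq_bigr => x _ do rewrite bigA_distr_bigA.
  rewrite exchange_big /= rmorphM rmorph_nat /wsum rmorph_sum mulr_suml.
  rewrite big_mkcond; apply: eq_bigr => p _.
  under [RHS]eq_bigr => x _ do rewrite big_split /=.
  rewrite -mulr_sumr orth // rmorph_prod.
  by case: ifP; rewrite ?mulr0.
exists Om, [ffun=> ord0], G; split=> //.
- move=> t c le_t; rewrite -lecR rmorph_sum.
  have re : (wsum phi c * #|Om|%:R)%:C%C <= `|(wsum phi c * #|Om|%:R)%:C%C|.
    by apply: real_ler_norm; apply/complex_realP; eexists.
  apply: le_trans re _; rewrite key //; apply: le_trans (ler_norm_sum _ _ _) _.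
  apply: ler_sum => x _; rewrite normr_prod rmorph_prod.
  by apply: ler_prod => k _; rewrite normr_ge0 FN /= GE lexx.
- move=> t c le_t; apply: complexI; rewrite /energy key // rmorph_sum.
  apply: eq_bigr => x _; rewrite rmorphXn /= GE.
  rewrite -(pair_bigA _ (fun b _ => F c b x)) /= big_bool /= !prodr_const card_ord.
  by rewrite -exprMn exprM -[F c false x]/(F c (~~ true) x) -Fconj -normCK.
- move=> c x c0; rewrite -lecR GE rmorph_sum; apply: le_trans (ler_norm_sum _ _ _) _.
  apply: ler_sum => a _; rewrite normrM chi1 mulr1 ger0_norm //.
  by rewrite ler0c.
Qed.
End Fourier.

(** * Hoelder inequality for energies *)

Section Holder.
Variables (R : rcfType) (T I : finType) (phi : T -> I -> int).

(** In the Fourier model this is Hoelder's inequality for 2t functions: divide each [G (c k)] by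
    [N k], apply AM-GM at every point and sum over the points. *)
Lemma wsum_holder t (c : slot t -> T -> R) (N : slot t -> R) : (0 < t)%N ->
  (forall k, 0 <= N k) -> (forall k, energy phi t (c k) <= N k ^+ (2 * t)) ->
  wsum phi c <= \prod_k N k.
Proof.
move=> t_gt0 N0 cN.
have [Om [x0 [G [G0 Gw Ge _]]]] := fourier_model R phi t.
have m_gt0 : 0 < #|Om|%:R :> R by rewrite ltr0n; apply/card_gt0P; exists x0.
rewrite -(ler_pM2r m_gt0); apply: le_trans (Gw _ _ (leqnn t)) _.
have cG k : \sum_x G (c k) x ^+ (2 * t) <= N k ^+ (2 * t) * #|Om|%:R.
  by rewrite -Ge // ler_pM2r.
(* Dividing by [N k] requires it to be non-zero. If it is zero, [G (c k)] vanishes identically and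
   so does the product. *)
have [/existsP[k /eqP Nk0]|] := boolP [exists k, N k == 0].
  rewrite [leRHS](_ : _ = 0); last by rewrite (bigD1 k) //= Nk0 !mul0r.
  have Gk0 x : G (c k) x = 0.
    have : G (c k) x ^+ (2 * t) == 0; last by rewrite expf_eq0 => /andP[_ /eqP].
    apply/eqP/le_anti; rewrite exprn_ge0 // andbT.
    have := cG k; rewrite Nk0 expr0n muln_eq0 (gtn_eqF t_gt0) mul0r.
    apply: le_trans; rewrite (bigD1 x) //= lerDl sumr_ge0 // => y _.
    by rewrite exprn_ge0.
  by rewrite big1 // => x _; rewrite (bigD1 k) //= Gk0 mul0r.
rewrite negb_exists => /forallP N_neq0.
have N_gt0 k : 0 < N k by rewrite lt_def N_neq0 N0.
have tt0 : (2 * t)%:R != 0 :> R by rewrite pnatr_eq0 muln_eq0 (gtn_eqF t_gt0).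
have AGM x : \prod_k G (c k) x <=
    (\prod_k N k) * (\sum_k (G (c k) x / N k) ^+ (2 * t) / (2 * t)%:R).
  have -> : \prod_k G (c k) x = (\prod_k N k) * \prod_k (G (c k) x / N k).
    by rewrite -big_split; apply: eq_bigr => k _ /=; rewrite mulrC divfK.
  rewrite ler_pM2l ?prodr_gt0 // -mulr_suml.
  rewrite -(@ler_pXn2r _ (2 * t)) ?muln_gt0 ?t_gt0 ?nnegrE //; last 2 first.
  - by apply: prodr_ge0 => k _; rewrite divr_ge0.
  - by rewrite divr_ge0 // sumr_ge0 // => k _; rewrite exprn_ge0 // divr_ge0.
  have := @leif_AGM R (slot t) predT (fun k => (G (c k) x / N k) ^+ (2 * t)).
  rewrite prodrXl -card_slot cardT => /(_ _) []//.
  by move=> k _; rewrite exprn_ge0 // divr_ge0.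
apply: le_trans (ler_sum _ (fun x _ => AGM x)) _.
rewrite -mulr_sumr ler_pM2l ?prodr_gt0 // exchange_big /=.
apply: le_trans (_ : \sum_(k : slot t) #|Om|%:R / (2 * t)%:R <= _).
  apply: ler_sum => k _; rewrite -mulr_suml ler_pM2r ?invr_gt0 ?lt_def ?tt0 ?ler0n //.
  under eq_bigr do rewrite exprMn.
  by rewrite -mulr_suml exprVn ler_pdivrMr ?exprn_gt0 // mulrC.
by rewrite sumr_const card_slot -[_ *+ _]mulr_natr divfK.
Qed.

Lemma energy_ge0 t (c : T -> R) : (forall a, 0 <= c a) -> 0 <= energy phi t c.
Proof. by move=> c0; apply: sumr_ge0 => p _; apply: prodr_ge0. Qed.

(** The energy is the mean of [G c x ^+ (2 * s)], and [G c] never exceeds the total mass, so the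
    surplus factors can be pulled out. *)
Lemma energy_reduce t s (c : T -> R) : (t <= s)%N -> (forall a, 0 <= c a) ->
  energy phi s c <= (\sum_a c a) ^+ (2 * (s - t)) * energy phi t c.
Proof.
move=> le_ts c0; have [Om [x0 [G [G0 _ Ge Gs]]]] := fourier_model R phi s.
have m_gt0 : 0 < #|Om|%:R :> R by rewrite ltr0n; apply/card_gt0P; exists x0.
rewrite -(ler_pM2r m_gt0) -mulrA !Ge // mulr_sumr; apply: ler_sum => x _.
rewrite -{1}(subnK le_ts) mulnDr exprD ler_wpM2r ?exprn_ge0 //.
by rewrite lerXn2r ?nnegrE ?sumr_ge0 // Gs.
Qed.

Lemma energy_scale t (w : R) (c : T -> R) :
  energy phi t (fun a => w * c a) = w ^+ (2 * t) * energy phi t c.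
Proof.
rewrite /energy /wsum mulr_sumr; apply: eq_bigr => p _.
by rewrite big_split /= prodr_const card_slot.
Qed.

Lemma energy_expand t (J : finType) (c : T -> R) (cJ : J -> T -> R) :
  (forall a, c a = \sum_j cJ j a) ->
  energy phi t c =
  \sum_(v : {ffun slot t -> J}) wsum phi (fun k => cJ (v k)).
Proof.
move=> cE; rewrite /energy /wsum exchange_big; apply: eq_bigr => p _ /=.
by under eq_bigr do rewrite cE; rewrite bigA_distr_bigA.
Qed.

(** This is the triangle inequality for the L^{2t} norm, stated without roots: expand multilinearly
    and bound every term by Hoelder. *)
Lemma energy_triangle t (J : finType) (w N : J -> R) (cJ : J -> T -> R)
    (c : T -> R) : (0 < t)%N ->
  (forall a, c a = \sum_j w j * cJ j a) ->
  (forall j, 0 <= w j) -> (forall j, 0 <= N j) ->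
  (forall j, energy phi t (cJ j) <= N j ^+ (2 * t)) ->
  energy phi t c <= (\sum_j w j * N j) ^+ (2 * t).
Proof.
move=> t0 cE w0 N0 cN; rewrite (energy_expand _ cE) -card_slot -prodr_const.
rewrite bigA_distr_bigA; apply: ler_sum => v _.
apply: (@wsum_holder _ _ (fun k => w (v k) * N (v k))) => // k.
  by rewrite mulr_ge0.
by rewrite exprMn energy_scale ler_wpM2l // exprn_ge0.
Qed.

(** Expand over the fibres of [f]. Coordinate [i] depends on the fibre label alone, so a choice of
    fibres contributes only if its labels are balanced, and Hoelder bounds each such contribution.
    What is left is a one-variable energy in the labels. *)
Lemma energy_fibers t (i : I) (J : finType) (iota : J -> int) (f : T -> J)
    (c : T -> R) (N : J -> R) : (0 < t)%N ->
  (forall a, 0 <= c a) -> (forall a, c a != 0 -> phi a i = iota (f a)) ->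
  (forall j, 0 <= N j) ->
  (forall j, energy phi t (fun a => if f a == j then c a else 0) <= N j ^+ (2 * t)) ->
  energy phi t c <= energy (fun j (_ : unit) => iota j) t N.
Proof.
move=> t0 c0 phif N0 cN.
rewrite (@energy_expand _ J _ (fun j a => if f a == j then c a else 0)); last first.
  move=> a; rewrite (bigD1 (f a)) //= eqxx big1 ?addr0 // => j.
  by rewrite eq_sym => /negPf ->.
rewrite [leRHS]/energy [leRHS]/wsum [leRHS]big_mkcond; apply: ler_sum => v _.
case: ifPn => [_|vN]; first exact: wsum_holder.
rewrite /wsum big1 // => p /forallP bp.
have [/forallP /= fv|] := boolP [forall k, (f (p k) == v k) && (c (p k) != 0)].
  case/negP: vN; apply/forallP=> _ /=.
  have := bp i; congr (_ == _); apply: eq_bigr => k _.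
  by have /andP[/eqP <- h] := fv k; rewrite phif.
rewrite negb_forall => /existsP[k]; rewrite negb_and negbK => h.
rewrite (bigD1 k) //=; case: ifPn h => [_ /=/eqP->|_ _]; by rewrite mul0r.
Qed.

End Holder.

(** * Energies of sequences on the line *)

(** The saving of a square root of 2t+1 over the trivial bound 4^t is the source of the gain for
    large [eta]. *)
Lemma central_bin_sqr t : ('C(2 * t, t) ^ 2 * (2 * t + 1) <= 16 ^ t)%N.
Proof.
elim: t => [|t IH]; first by rewrite bin0.
have e1 : ((t + 1) * 'C(2 * t.+1, t.+1) = 2 * (2 * t + 1) * 'C(2 * t, t))%N.
  have h := mul_bin_diag (2 * t).+1 t; rewrite /= in h.
  have -> : (2 * t.+1 = (2 * t).+2)%N by lia.
  rewrite binS -(@bin_sub (2 * t).+1 t); last by lia.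
  have -> : ((2 * t).+1 - t = t.+1)%N by lia.
  by nia.
have : ((t + 1) ^ 2 * ('C(2 * t.+1, t.+1) ^ 2 * (2 * t.+1 + 1)) <=
        (t + 1) ^ 2 * 16 ^ t.+1)%N.
  rewrite mulnA -expnMn e1 (expnS 16) !expnMn.
  apply: (@leq_trans (4 * ((2 * t + 1) * (2 * t + 3)) * 16 ^ t)); last first.
    by rewrite [leqRHS]mulnA leq_mul // ; nia.
  have := leq_mul (leqnn (4 * ((2 * t + 1) * (2 * t + 3)))) IH.
  by apply: leq_trans; nia.
by rewrite leq_pmul2l // expn_gt0 addn1.
Qed.

Section OneDim.
Variables (R : rcfType) (J : finType) (iota : J -> int).
Hypothesis iota_inj : injective iota.
Local Notation E := (@energy R J unit (fun j _ => iota j)).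

Lemma energy_le_total (T I : finType) (phi : T -> I -> int) t (c : T -> R) :
  (forall a, 0 <= c a) -> energy phi t c <= (\sum_a c a) ^+ (2 * t).
Proof.
move=> c0; rewrite -card_slot -prodr_const bigA_distr_bigA /energy /wsum big_mkcond.
by apply: ler_sum => p _; case: ifP => // _; apply: prodr_ge0.
Qed.

(* A balanced tuple cannot have exactly one entry different from j0. *)
Lemma energy_drop_single t (c : J -> R) j0 : (0 < t)%N -> (forall j, 0 <= c j) ->
  E t c <= (\sum_j c j) ^+ (2 * t)
           - (2 * t)%:R * (\sum_(j | j != j0) c j) * c j0 ^+ (2 * t).-1.
Proof.
move=> t0 c0; rewrite lerBrDr.
(* A tuple in the family [Q k] has its only exceptional entry at slot [k]. The families are
   therefore disjoint, and none of their members is balanced. *)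
pose Q (k k' : slot t) : pred J := if k' == k then predC1 j0 else pred1 j0.
have -> : (2 * t)%:R * (\sum_(j | j != j0) c j) * c j0 ^+ (2 * t).-1 =
    \sum_k \sum_(p : {ffun slot t -> J} | p \in family (Q k)) \prod_k' c (p k').
  transitivity (\sum_(k : slot t) (\sum_(j | j != j0) c j) * c j0 ^+ (2 * t).-1).
    by rewrite sumr_const card_slot -mulrA mulr_natl.
  apply: eq_bigr => k _.
  rewrite -(bigA_distr_big_dep (Q k) (fun _ j => c j)) (bigD1 k) //=.
  congr (_ * _); first by apply: eq_bigl => j; rewrite /Q eqxx.
  rewrite -(card_slot t) -(cardC1 k) -prodr_const; apply: eq_big => k' // nk.
  by apply/esym/big_pred1 => j; rewrite /Q (negPf nk).
rewrite -card_slot -prodr_const bigA_distr_bigA /energy /wsum big_mkcond.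
under [X in _ + X]eq_bigr do rewrite big_mkcond.
rewrite exchange_big -big_split; apply: ler_sum => p _ /=.
have P0 : 0 <= \prod_k c (p k) by apply: prodr_ge0.
have [/existsP[k pk]|] := boolP [exists k, p \in family (Q k)]; last first.
  rewrite negb_exists => /forallP np; rewrite [X in _ + X]big1 => [|k _].
    by rewrite addr0; case: ifP => // _; rewrite lexx.
  by rewrite (negPf (np k)).
have pkP := familyP pk.
have pk0 : p k != j0 by have := pkP k; rewrite /Q eqxx.
have pk' k' : k' != k -> p k' = j0.
  by move=> nk; have := pkP k'; rewrite /Q (negPf nk) => /eqP.
rewrite [X in _ + X](bigD1 k) //= pk [X in _ + (_ + X)]big1 ?addr0; last first.
  move=> k' nk; case: ifP => // /familyP/(_ k'); rewrite /Q eqxx inE pk' //.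
  by rewrite eqxx.
rewrite ifF ?add0r //; apply/negP => /forallP/(_ tt)/eqP.
have := @sum_slot_sign t (iota j0); rewrite (bigD1 k) //= => e1.
rewrite (bigD1 k) //= => e2.
have e3 : slot_sign k.1 * iota (p k) = slot_sign k.1 * iota j0.
  apply: (@addIr _ (\sum_(i | i != k) slot_sign i.1 * iota j0)); rewrite e1 -[RHS]e2.
  by congr (_ + _); apply: eq_bigr => k' nk; rewrite pk'.
case/eqP: pk0; apply: iota_inj; move: e3; case: k.1; rewrite /slot_sign; lia.
Qed.

(** With two available values, send a tuple to the slots where the statement that the value is [j]
    agrees with the side of the slot. This is injective, and balance forces the image to have
    exactly [t] elements. *)
Lemma energy_pair t (j k : J) : j != k ->
  E t (fun x => (x == j)%:R + (x == k)%:R) <= ('C(2 * t, t))%:R.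
Proof.
move=> jk; pose D := [set p : {ffun slot t -> J} |
  balanced (fun j (_ : unit) => iota j) p & [forall u, (p u == j) || (p u == k)]].
have -> : E t (fun x => (x == j)%:R + (x == k)%:R) = #|D|%:R.
  rewrite -sum1_card natr_sum /energy /wsum big_mkcond [RHS]big_mkcond.
  apply: eq_bigr => p _; rewrite inE; case: (balanced _ p) => //=.
  case: ifPn => [/forallP h|].
    rewrite big1 // => u _; have := h u.
    case: eqP => [->|_ /= ->]; last by rewrite add0r.
    by rewrite (negPf jk) addr0.
  rewrite negb_forall => /existsP[u]; rewrite negb_or => /andP[/negPf n1 /negPf n2].
  by rewrite (bigD1 u) //= n1 n2 addr0 mul0r.
rewrite ler_nat -[(2 * t)%N]card_slot -card_draws.
pose U (p : {ffun slot t -> J}) := [set u : slot t | (p u == j) == u.1].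
have Uinj : {in D &, injective U}.
  move=> p q; rewrite !inE => /andP[_ /forallP hp] /andP[_ /forallP hq] /finset.setP Upq.
  apply/ffunP => u; have := Upq u; rewrite !inE.
  have := hp u; have := hq u.
  case: (eqVneq (p u) j) => [->|_]; case: (eqVneq (q u) j) => [->|_] //=.
  - by case: u.1.
  - by case: u.1.
  - by move=> /eqP-> /eqP->.
rewrite -(card_in_imset Uinj); apply/subset_leq_card/fintype.subsetP => _ /imsetP[p pD ->].
rewrite inE; move: pD; rewrite inE => /andP[/forallP/(_ tt)/eqP bp /forallP hp].
have s0 : \sum_(u : slot t) slot_sign u.1 * (p u == j)%:R = 0.
  have : (iota j - iota k) * (\sum_(u : slot t) slot_sign u.1 * (p u == j)%:R) = 0.
    transitivity (\sum_(u : slot t) slot_sign u.1 * iota (p u) -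
                  \sum_(u : slot t) slot_sign u.1 * iota k); last first.
      by rewrite bp sum_slot_sign subrr.
    rewrite -sumrB mulr_sumr.
    apply: eq_bigr => u _; rewrite -mulrBr mulrCA; congr (_ * _).
    have := hp u; case: eqP => [->|_ /= /eqP->]; first by rewrite mulr1.
    by rewrite mulr0 subrr.
  move/eqP; rewrite mulf_eq0 subr_eq0 => /orP[/eqP/iota_inj/eqP|/eqP//].
  by rewrite (negPf jk).
have : #|U p|%:Z = t%:Z; last by move=> [->].
rewrite -sum1_card -natz natr_sum.
transitivity (\sum_(u : slot t) (slot_sign u.1 * (p u == j)%:R + (~~ u.1)%:R)).
  rewrite big_mkcond; apply: eq_bigr => u _; rewrite inE /slot_sign.
  by case: u.1; case: (p u == j).
rewrite big_split /= s0 add0r -(pair_bigA _ (fun b (i : 'I_t) => (~~ b)%:R)) /=.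
rewrite big_bool /= !sumr_const card_ord mul0rn add0r; exact: natz.
Qed.

(* Averaging (chi_j + chi_k)/2 against c_j c_k recovers sum c_j chi_j. *)
Lemma energy_concentrate t (c : J -> R) j0 (r : R) : (0 < t)%N ->
  (forall j, 0 <= c j) -> (forall j, c j <= c j0) -> 0 < c j0 -> 0 <= r <= 1 ->
  ('C(2 * t, t))%:R <= (2 * r) ^+ (2 * t) ->
  E t c <= (\sum_j c j - (1 - r) * (\sum_(j | j != j0) c j)) ^+ (2 * t).
Proof.
move=> t0 c0 cm cj0 /andP[r0 r1] binr.
set ct := \sum_j c j; set b := \sum_(j | j != j0) c j.
have ctE : ct = c j0 + b by rewrite /ct (bigD1 j0).
have b0 : 0 <= b by apply: sumr_ge0.
have ct0 : 0 < ct by rewrite ctE ltr_pwDl.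
(* The pair (j, k) gets weight c_j c_k / ct. Its norm bound is 1 on the diagonal and [r] elsewhere,
   by the two-point energy. *)
pose w (u : J * J) := c u.1 * c u.2 / ct.
pose N (u : J * J) := if u.1 == u.2 then 1 else r.
pose cJ (u : J * J) x : R := ((x == u.1)%:R + (x == u.2)%:R) / 2.
have sum1 (j : J) : \sum_x (x == j)%:R = 1 :> R.
  by rewrite (bigD1 j) //= eqxx big1 ?addr0 // => x /negPf->.
have h : E t c <= (\sum_u w u * N u) ^+ (2 * t).
  apply: (@energy_triangle _ _ _ _ _ _ w N cJ) => //.
  - move=> a; rewrite -(pair_bigA _ (fun j k => w (j, k) * cJ (j, k) a)) /=.
    have e j k : w (j, k) * cJ (j, k) a =
        (2 * ct)^-1 * ((a == j)%:R * c j * c k + c j * ((a == k)%:R * c k)).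
      by rewrite /w /cJ /=; field; rewrite (lt0r_neq0 ct0).
    under eq_bigr => j _ do under eq_bigr => k _ do rewrite e.
    under eq_bigr => j _ do rewrite -mulr_sumr big_split /= -!mulr_sumr -/ct.
    rewrite -mulr_sumr big_split /= -!mulr_suml -/ct.
    have -> : \sum_j (a == j)%:R * c j = c a.
      rewrite (bigD1 a) //= eqxx mul1r big1 ?addr0 // => j.
      by rewrite eq_sym => /negPf->; rewrite mul0r.
    by field; exact: lt0r_neq0.
  - by move=> u; rewrite /w divr_ge0 ?mulr_ge0 // ltW.
  - by move=> u; rewrite /N; case: ifP.
  - move=> u; rewrite /N; case: eqP => [e|/eqP ne].
      apply: le_trans (energy_le_total _ _ _) _.
        by move=> a; rewrite divr_ge0 // addr_ge0.
      rewrite /cJ -e -mulr_suml big_split /= sum1 expr1n.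
      by rewrite (_ : (1 + 1) / 2 = 1) ?expr1n //; field.
    have -> : E t (cJ u) = 2^-1 ^+ (2 * t) * E t (fun x => (x == u.1)%:R + (x == u.2)%:R).
      by rewrite -energy_scale; congr energy; apply/funext => x; rewrite mulrC.
    rewrite exprVn mulrC ler_pdivrMr ?exprn_gt0 // -exprMn [r * 2]mulrC.
    exact: le_trans (energy_pair _ ne) binr.
apply: le_trans h _.
apply: lerXn2r; rewrite ?nnegrE.
- by apply: sumr_ge0 => u _; rewrite mulr_ge0 /w /N ?divr_ge0 ?mulr_ge0 // ?(ltW ct0) //; case: ifP.
- by rewrite subr_ge0 (le_trans (_ : _ <= 1 * b)) ?ler_wpM2r // ?mul1r; lra.
have -> : \sum_u w u * N u = (r * (ct * ct) + (1 - r) * \sum_j c j * c j) / ct.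
  rewrite -(pair_bigA _ (fun j k => w (j, k) * N (j, k))) /=.
  rewrite {2}/ct mulr_suml !mulr_sumr -big_split /= mulr_suml; apply: eq_bigr => j _.
  rewrite /w /N /= /ct mulr_sumr -/ct !mulr_sumr.
  rewrite (bigD1 j) //= eqxx [in RHS](bigD1 j) //=.
  have -> : \sum_(i | i != j) c j * c i / ct * (if j == i then 1 else r) =
            (\sum_(i | i != j) r * (c j * c i)) / ct.
    rewrite mulr_suml; apply: eq_bigr => i; rewrite eq_sym => /negPf ->.
    by ring.
  by field; exact: lt0r_neq0.
rewrite ler_pdivrMr //.
(* Maximality of [c j0] controls the diagonal mass; the total is then at most r ct + (1 - r) c_{j0},
   which is the claimed base. *)
have : \sum_j c j * c j <= c j0 * ct.
  by rewrite mulr_sumr; apply: ler_sum => j _; rewrite ler_wpM2r.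
move: (\sum_j c j * c j) => q hq.
have -> : b = ct - c j0 by rewrite ctE; ring.
have : 0 <= (1 - r) * (c j0 * ct - q) by rewrite mulr_ge0 // subr_ge0.
lra.
Qed.
End OneDim.

(** * The one-variable inequality *)

Section RealFacts.
Variable R : realType.
Implicit Types x y z : R.

Lemma expR_le1D2x z : 0 <= z <= 1 / 2 -> expR z <= 1 + 2 * z.
Proof.
move=> /andP[z0 z1]; have h := expR_ge1Dx (- z); have p := expR_gt0 z.
rewrite expRN in h.
have : expR z * (1 - z) <= 1 by rewrite mulrC -ler_pdivlMr // div1r; lra.
by nra.
Qed.

Lemma expRN_le z : 0 <= z <= 1 -> expR (- z) <= 1 - z / 2.
Proof.
move=> /andP[z0 z1]; have h := expR_ge1Dx z; have p := expR_gt0 z.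
rewrite expRN; have : (expR z)^-1 * (1 + z) <= 1.
  by rewrite mulrC ler_pdivrMr // mul1r.
have : 0 < (expR z)^-1 by rewrite invr_gt0.
by nra.
Qed.

Lemma bernoulli_sqr x n : 0 <= x -> n%:R * x <= 1 ->
  (1 + x) ^+ n <= 1 + n%:R * x + (n%:R * x) ^+ 2.
Proof.
move=> x0; elim: n => [|n IH]; first by rewrite expr0 mul0r; lra.
rewrite exprSr -[n.+1]addn1 natrD => nx.
have nx' : n%:R * x <= 1 by lra.
have n0 : 0 <= n%:R :> R by [].
apply: le_trans (ler_wpM2r _ (IH nx')) _; first by lra.
have h : n%:R * x * (n%:R * x * x) <= 1 * (n%:R * x * x).
  by apply: ler_wpM2r => //; rewrite !mulr_ge0.
have h2 : 0 <= x * x by rewrite mulr_ge0.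
by move: h h2 n0; move: (n%:R : R) => m; nra.
Qed.

Lemma bernoulli_sub x n : 0 <= x <= 1 -> 1 - n%:R * x <= (1 - x) ^+ n.
Proof.
move=> /andP[x0 x1]; elim: n => [|n IH]; first by rewrite expr0 mul0r; lra.
rewrite exprSr -[n.+1]addn1 natrD.
apply: le_trans (ler_wpM2r _ IH); last by lra.
have n0 : 0 <= n%:R * (x * x) by rewrite mulr_ge0 // mulr_ge0.
by lra.
Qed.
End RealFacts.

Section Core.
Variables (R : realType) (J : finType) (iota : J -> int).
Hypothesis iota_inj : injective iota.
Local Notation E := (@energy R J unit (fun j _ => iota j)).
Variables (kap H S S1 : R) (s s1 : nat).
(** [S] and [S1] are the numbers of slots at the full length [s] and at an auxiliary shorter length
    [s1]. The last two conditions let the gain beat the loss: [S1] against log S for small [eta],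
    and log S against log S1 for large [eta]. *)
Hypotheses (SE : S = (2 * s)%:R) (S1E : S1 = (2 * s1)%:R) (kap_gt0 : 0 < kap)
  (kapS : 4 * kap <= S) (H_ge1 : 1 <= H)
  (S32 : 32 <= S) (kaplnS : kap * (ln H + 4 * ln S) <= S / 2)
  (s1s : (0 < s1 <= s)%N) (S1_large : 4 * kap * (1 + 2 * (ln H + 4 * ln S)) <= S1)
  (lnS_large : 4 * kap * (1 + 2 * ln (6 * H * S1)) <= ln S / 2).

(* [eta] is the proportion of the set lying outside the fibre [j0].  For tiny [eta]
   the term with a single exceptional entry cancels the first-order loss exactly;
   in the intermediate range that term is already a sufficient gain at the shorter
   length [s1]; for large [eta] the gain comes from concentration. *)
Variables (c : J -> R) (j0 : J) (eta : R).
Hypotheses (c_ge0 : forall j, 0 <= c j) (c_max : forall j, c j <= c j0)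
  (eta01 : 0 <= eta <= 1).
Let al := kap / S.
Let b := \sum_(j | j != j0) c j.
Hypotheses (c0_le : c j0 <= 1 - (1 - al) * eta) (b_le0 : eta = 0 -> b <= 0)
  (b_le : 0 < eta -> b <= eta * expR (al * (ln H - ln eta))).

Let S_gt0 : 0 < S. Proof. by apply: lt_le_trans S32. Qed.
Let s_gt0 : (0 < s)%N. Proof. by move: S_gt0; rewrite SE ltr0n muln_gt0. Qed.
Let al_gt0 : 0 < al. Proof. by rewrite divr_gt0. Qed.
Let al_le : al <= 1 / 4. Proof. by rewrite ler_pdivrMr //; move: (kapS) => ?; lra. Qed.
Let alS : al * S = kap. Proof. by rewrite divfK ?lt0r_neq0. Qed.
Let b_ge0 : 0 <= b. Proof. exact: sumr_ge0. Qed.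
Let lnH0 : 0 <= ln H. Proof. exact: ln_ge0. Qed.
Let lnS0 : 0 <= ln S. Proof. by apply: ln_ge0; apply: le_trans S32; rewrite ler1n. Qed.

Local Ltac intro_hyps := move: (kap_gt0) (H_ge1) (S32) (c0_le) (S_gt0) (al_gt0)
  (al_le) (b_ge0) (lnH0) (lnS0) => ? ? ? ? ? ? ? ? ? ?.

(** With u = eta^{1/4} the hypotheses give b <= 2 u^3. For x = b / c_{j0}, the term linear in x
    cancels, leaving (1 + x)^S - S x <= 1 + (S x)^2 <= exp(16 eta). The factor c_{j0}^S <= exp(-3 S
    eta / 4) absorbs this since S >= 32. *)
Lemma one_dim_tiny : 1 < c j0 + b -> 0 < eta -> eta * S ^+ 4 <= 1 -> E s c <= 1.
Proof.
intro_hyps.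
move=> c_gt1 eta0 etaS; have [_ eta1] := andP eta01.
pose u := expR (ln eta / 4).
have u0 : 0 < u by apply: expR_gt0.
have u4 : u ^+ 4 = eta.
  by rewrite -expRM_natl mulrC divfK // lnK.
have uS : u * S <= 1.
  rewrite -(@ler_pXn2r _ 4) ?nnegrE //; last by rewrite mulr_ge0 // ltW.
  by rewrite expr1n exprMn u4.
have lneta : ln eta <= 0 by apply: ln_le0.
have bu : b <= 2 * u ^+ 3.
  apply: le_trans (b_le eta0) _.
  have e1 : expR (al * ln H) <= 2.
    have hh : al * ln H <= 1 / 2.
      rewrite -(ler_pM2r S_gt0) mulrAC alS.
      have : 0 <= kap * (4 * ln S) by rewrite !mulr_ge0 // ltW.
      by move: (kaplnS) => ?; lra.
    have : expR (al * ln H) <= 1 + 2 * (al * ln H); last by lra.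
    by apply: expR_le1D2x; rewrite hh andbT mulr_ge0 // ltW.
  have e2 : expR (- (al * ln eta)) <= u^-1.
    rewrite -expRN ler_expR; have : (1 / 4 - al) * ln eta <= 0.
      by rewrite mulr_ge0_le0 // subr_ge0.
    by lra.
  rewrite mulrBr expRD -{1}u4 (_ : 2 * u ^+ 3 = u ^+ 4 * (2 * u^-1)); last first.
    by field; rewrite lt0r_neq0.
  rewrite ler_pM2l ?exprn_gt0 //.
  by apply: ler_pM => //; exact: expR_ge0.
have S2 : 32 * u <= 1 by nra.
have u2 : 0 < u * u by rewrite mulr_gt0.
have c0h : 1 / 2 <= c j0.
  have : u ^+ 3 <= u by rewrite !exprS expr0 mulr1; nra.
  by lra.
have c0p : 0 < c j0 by lra.
apply: le_trans (energy_drop_single iota_inj j0 s_gt0 c_ge0) _.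
rewrite (bigD1 j0) //= -/b -SE.
pose x := b / c j0.
have x0 : 0 <= x by rewrite divr_ge0 // ltW.
have bx : b = c j0 * x by rewrite /x mulrC divfK // lt0r_neq0.
have xu : x <= 4 * u ^+ 3.
  rewrite ler_pdivrMr //; apply: le_trans bu _.
  have : 0 < u ^+ 3 by rewrite exprn_gt0.
  by nra.
have Sx : S * x <= 4 * u ^+ 2.
  apply: le_trans (ler_wpM2l (ltW S_gt0) xu) _.
  have : u ^+ 2 * (u * S) <= u ^+ 2 * 1 by rewrite ler_pM2l ?exprn_gt0.
  by rewrite !exprS expr0; lra.
have Sx1 : S * x <= 1.
  by apply: le_trans Sx _; rewrite expr2; nra.
have -> : c j0 + b = c j0 * (1 + x) by rewrite bx; ring.
rewrite exprMn bx.
have -> : S * (c j0 * x) * c j0 ^+ (2 * s).-1 = c j0 ^+ (2 * s) * (S * x).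
  by rewrite -[in RHS](prednK (_ : 0 < 2 * s)%N) ?muln_gt0 // exprS; ring.
rewrite -mulrBr.
apply: (@le_trans _ _ (expR (- (3 / 4 * eta)) ^+ (2 * s) * expR (16 * eta))); last first.
  rewrite -expRM_natl -SE -expRD -[leRHS]expR0 ler_expR.
  have : 0 <= (S - 32) * eta by rewrite mulr_ge0 // ?subr_ge0 // ltW.
  by lra.
apply: ler_pM.
- by rewrite exprn_ge0.
- have : 1 + S * x <= (1 + x) ^+ (2 * s); last by lra.
  rewrite SE; elim: (2 * s)%N => [|n IH]; first by rewrite mul0r expr0 addr0.
  rewrite exprSr -[n.+1]addn1 natrD.
  have : 0 <= n%:R * (x * x) by rewrite mulr_ge0 // mulr_ge0.
  have := ler_wpM2r (_ : 0 <= 1 + x) IH; rewrite addr_ge0 // => /(_ isT).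
  by lra.
- apply: lerXn2r; rewrite ?nnegrE ?expR_ge0 //.
  apply: le_trans c0_le _; apply: le_trans (expR_ge1Dx _).
  have : (3 / 4) * eta <= (1 - al) * eta by rewrite ler_pM2r //; lra.
  by lra.
- apply: le_trans (expR_ge1Dx _).
  have : (1 + x) ^+ (2 * s) <= 1 + S * x + (S * x) ^+ 2.
    by move: Sx1; rewrite SE; apply: bernoulli_sqr.
  have : (S * x) ^+ 2 <= (4 * u ^+ 2) ^+ 2.
    have a1 : 0 <= S * x by rewrite mulr_ge0 // ltW.
    have a2 : 0 <= 4 * u ^+ 2 by rewrite mulr_ge0 // exprn_ge0 // ltW.
    by apply: lerXn2r; rewrite ?nnegrE.
  by rewrite -u4 (_ : (4 * u ^+ 2) ^+ 2 = 16 * u ^+ 4); [lra | ring].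
Qed.

Let ct := c j0 + b.

(** The loss to be compensated: [c0_le] and [b_le] together give ct <= 1 + eta (al + 2 al l), and al
    S = kap. *)
Lemma total_pow_bound l : 0 < eta -> ln H - ln eta <= l -> al * l <= 1 / 2 ->
  b <= 2 * eta /\ ct ^+ (2 * s) <= expR (eta * (kap * (1 + 2 * l))).
Proof.
intro_hyps.
move=> eta0 ll all2; have [_ eta1] := andP eta01.
have lneta : ln eta <= 0 by apply: ln_le0.
have l0 : 0 <= l by lra.
have z0 : 0 <= al * l by rewrite mulr_ge0 // ltW.
have bz : b <= eta * (1 + 2 * (al * l)).
  apply: le_trans (b_le eta0) _; rewrite ler_pM2l //.
  apply: le_trans (_ : expR (al * l) <= _).
    by rewrite ler_expR ler_pM2l.
  by apply: expR_le1D2x; rewrite z0.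
split.
  by apply: le_trans bz _; rewrite mulrC ler_pM2r //; lra.
have -> : eta * (kap * (1 + 2 * l)) = S * (eta * (al + 2 * (al * l))).
  by rewrite -alS; ring.
rewrite SE expRM_natl; apply: lerXn2r; rewrite ?nnegrE ?expR_ge0 //.
  by rewrite addr_ge0.
apply: le_trans (expR_ge1Dx _); rewrite /ct.
by lra.
Qed.

(** If b were below ct eta / 2, then ct (1 - eta / 2) < c_{j0} <= 1 - 3 eta / 4, which is impossible
    for ct > 1. *)
Lemma half_eta_le : 1 < ct -> ct * eta <= 2 * b.
Proof.
intro_hyps.
move=> c1; have [eta0 eta1] := andP eta01.
rewrite leNgt; apply/negP => h.
have h1 : (3 / 4) * eta <= (1 - al) * eta by rewrite ler_wpM2r //; lra.
have h2 : 1 * (1 - eta / 2) <= ct * (1 - eta / 2).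
  by rewrite ler_wpM2r //; [lra | exact: ltW].
by move: h h2; rewrite /ct; lra.
Qed.

(** At full length S eta may be large, so the energy is first reduced to length [s1], where S1 eta
    <= 1/6. There the tuples with one exceptional entry save a factor exp(-S1 eta / 4), which beats
    the loss of [total_pow_bound] with l = ln H + 4 ln S. *)
Lemma one_dim_small : 1 < ct -> 1 < eta * S ^+ 4 -> 6 * S1 * eta <= 1 -> E s c <= 1.
Proof.
intro_hyps.
move=> c1 etaS etaS1; have [eta0' eta1] := andP eta01.
have S40 : 0 < S ^+ 4 by rewrite exprn_gt0.
have eta0 : 0 < eta by nra.
have lneta : - ln eta <= 4 * ln S.
  have : 0 <= ln (eta * S ^+ 4) by apply: ln_ge0; apply: ltW.
  by rewrite lnM ?posrE // lnXn // -mulr_natl; lra.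
pose l := ln H + 4 * ln S.
have [||b2 ctS] := @total_pow_bound l eta0; rewrite /l.
- by lra.
- by rewrite -(ler_pM2r S_gt0) mulrAC alS; move: (kaplnS) => ?; lra.
have [s1_gt0 s1_le] := andP s1s.
have S10 : 0 < S1 by rewrite S1E ltr0n muln_gt0.
have ct0 : 0 < ct by lra.
have hb := half_eta_le c1.
apply: le_trans (energy_reduce _ s1_le c_ge0) _.
rewrite (bigD1 j0) //= -/b -/ct.
apply: le_trans (ler_wpM2l _ (energy_drop_single iota_inj j0 s1_gt0 c_ge0)) _.
  by rewrite exprn_ge0 // ltW.
rewrite [X in X ^+ (2 * s1)](bigD1 j0) //= -/b -/ct -S1E.
pose rho := b / ct.
have rho0 : 0 <= rho by rewrite divr_ge0 // ltW.
have bE : b = ct * rho by rewrite /rho mulrC divfK // lt0r_neq0.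
have rho_eta : eta <= 2 * rho by rewrite /rho mulrA ler_pdivlMr // mulrC.
have rho_le : rho <= 2 * eta.
  by rewrite ler_pdivrMr //; apply: le_trans b2 _; rewrite ler_peMr ?ltW // mulr_gt0.
have c0E : c j0 = ct * (1 - rho) by rewrite mulrBr -bE mulr1 /ct addrK.
have S1rho : S1 * rho <= 1 / 2.
  have := ler_wpM2l (ltW S10) rho_le; lra.
have rho1 : rho <= 1.
  have : 1 <= S1 by rewrite S1E ler1n muln_gt0.
  by nra.
have pw : 1 / 2 <= (1 - rho) ^+ (2 * s1).-1.
  apply: le_trans (bernoulli_sub _ _); last by rewrite rho0.
  have : (2 * s1).-1%:R * rho <= S1 * rho.
    by rewrite S1E ler_wpM2r // ler_nat leq_pred.
  by lra.
have e1 : ct ^+ (2 * s1) - S1 * b * c j0 ^+ (2 * s1).-1 =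
   ct ^+ (2 * s1) * (1 - S1 * rho * (1 - rho) ^+ (2 * s1).-1).
  rewrite c0E [b]bE exprMn -[in ct ^+ (2 * s1)](prednK (_ : 0 < 2 * s1)%N) ?muln_gt0 //.
  by rewrite exprS; ring.
rewrite e1 mulrA -exprD -mulnDr subnK //.
apply: (@le_trans _ _ (expR (eta * (kap * (1 + 2 * l))) * expR (- (S1 * eta / 4)))); last first.
  rewrite -expRD -[leRHS]expR0 ler_expR.
  have : eta * (4 * kap * (1 + 2 * l)) <= eta * S1 by rewrite ler_pM2l.
  by lra.
have g1 : 1 - S1 * rho * (1 - rho) ^+ (2 * s1).-1 <= expR (- (S1 * eta / 4)).
  apply: le_trans (expR_ge1Dx _).
  have h1 : S1 * rho * (1 / 2) <= S1 * rho * (1 - rho) ^+ (2 * s1).-1.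
    by rewrite ler_wpM2l // mulr_ge0 // ltW.
  have : S1 * eta <= S1 * (2 * rho) by rewrite ler_pM2l.
  by lra.
apply: le_trans (ler_wpM2l _ g1) _; first by rewrite exprn_ge0 // ltW.
by rewrite ler_pM2r ?expR_gt0.
Qed.

(** Since eta > 1 / (6 S1), the loss involves only ln (6 H S1). Concentration on pairs gains
    exp(-eta ln S / 8), which is larger by [lnS_large]. *)
Lemma one_dim_large : 1 < ct -> 1 < 6 * S1 * eta -> E s c <= 1.
Proof.
intro_hyps.
move=> c1 etaS1; have [eta0' eta1] := andP eta01.
have [s1_gt0 s1_le] := andP s1s.
have S10 : 0 < S1 by rewrite S1E ltr0n muln_gt0.
have eta0 : 0 < eta by nra.
have H0 : 0 < H by lra.
pose l := ln (6 * H * S1).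
have ll : ln H - ln eta <= l.
  have : 0 <= ln (6 * S1 * eta) by apply: ln_ge0; apply: ltW.
  rewrite /l mulrAC !lnM ?posrE // ?mulr_gt0 //; lra.
have lneta : ln eta <= 0 by apply: ln_le0.
have lnSle : ln S <= S by apply: ltW; apply: ln_sublinear.
have l0 : 0 <= l by lra.
have [//||b2 ctS] := @total_pow_bound l eta0.
  rewrite -(ler_pM2r S_gt0) mulrAC alS; move: lnS_large; rewrite -/l; lra.
have ct0 : 0 < ct by lra.
have hb := half_eta_le c1.
(* This choice gives r^{2S} = 1 / S, so (2r)^{2s} equals 4^s divided by the square root of S, an
   upper bound for the central binomial coefficient. *)
pose L := ln S / 2; pose y := L / S; pose r := expR (- y).
have y0 : 0 <= y by apply: divr_ge0; [rewrite /L; lra | exact: ltW].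
have y1 : y <= 1 by rewrite ler_pdivrMr // /L; lra.
have yS : y * S = L by rewrite divfK ?lt0r_neq0.
have r_le : r <= 1 - y / 2 by apply: expRN_le; rewrite y0.
have r0 : 0 <= r by apply: expR_ge0.
have cj0 : 0 < c j0.
  rewrite lt_def c_ge0 andbT; apply/eqP => c00.
  have : ct = 0; last by move=> ct00; move: ct0; rewrite ct00 ltxx.
  rewrite /ct c00 add0r /b big1 // => j _; apply/le_anti.
  by rewrite c_ge0 -[X in _ <= X]c00 c_max.
have binr : ('C(2 * s, s))%:R <= (2 * r) ^+ (2 * s).
  rewrite -(@ler_pXn2r _ 2) ?nnegrE //; last by rewrite exprn_ge0 // mulr_ge0.
  have e16 : 2 ^+ (2 * s * 2) = 16 ^+ s :> R.
    have -> : (2 * s * 2 = 4 * s)%N by rewrite mulnAC.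
    by rewrite exprM -natrX.
  have -> : ((2 * r) ^+ (2 * s)) ^+ 2 = 16 ^+ s / S.
    rewrite exprMn exprMn -exprM -exprM e16 /r -expRM_natl natrM -SE.
    have -> : S * 2 * - y = - ln S by rewrite mulrN mulrAC [S * y]mulrC yS /L; lra.
    by rewrite expRN lnK ?posrE.
  rewrite ler_pdivlMr // SE.
  have : ('C(2 * s, s) ^ 2 * (2 * s) <= 16 ^ s)%N.
    by apply: leq_trans (central_bin_sqr s); rewrite leq_mul2l leq_addr orbT.
  by rewrite -(ler_nat R) natrM !natrX.
have r1 : r <= 1 by lra.
apply: le_trans (energy_concentrate iota_inj s_gt0 c_ge0 c_max cj0 _ binr) _.
  by rewrite r0.
rewrite (bigD1 j0) //= -/b -/ct.
have h1 : y / 2 * b <= (1 - r) * b by rewrite ler_wpM2r //; lra.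
have h2 : y * (ct * eta) <= y * (2 * b) by rewrite ler_wpM2l.
apply: (@le_trans _ _ ((ct * expR (- (y * eta / 4))) ^+ (2 * s))).
  apply: lerXn2r; rewrite ?nnegrE.
  - have : (1 - r) * b <= 1 * b by rewrite ler_wpM2r //; lra.
    have : b <= ct by rewrite /ct lerDr.
    by lra.
  - by rewrite mulr_ge0 ?expR_ge0 // ltW.
  have := ler_wpM2l (ltW ct0) (expR_ge1Dx (- (y * eta / 4))); lra.
rewrite exprMn -expRM_natl -SE.
apply: (@le_trans _ _ (expR (eta * (kap * (1 + 2 * l))) * expR (S * - (y * eta / 4)))).
  by rewrite ler_pM2r ?expR_gt0.
rewrite -expRD -[leRHS]expR0 ler_expR.
have -> : S * - (y * eta / 4) = - (eta * L / 4) by rewrite -yS; field.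
have : eta * (4 * kap * (1 + 2 * l)) <= eta * L by rewrite ler_pM2l.
by lra.
Qed.

Lemma one_dim_core : E s c <= 1.
Proof.
intro_hyps.
have [eta0 eta1] := andP eta01.
have [c1|c1] := leP ct 1.
  apply: le_trans (energy_le_total _ _ c_ge0) _; rewrite (bigD1 j0) //= -/b -/ct.
  by apply: exprn_ile1 => //; rewrite addr_ge0.
have {}eta0 : 0 < eta.
  rewrite lt_def eta0 andbT; apply/eqP => e0.
  move: c1 c0_le; rewrite /ct e0 => c1 c0l; have := b_le0 e0; lra.
have [etaS|etaS] := leP (eta * S ^+ 4) 1; first exact: one_dim_tiny.
have [etaS1|etaS1] := leP (6 * S1 * eta) 1; first exact: one_dim_small.
exact: one_dim_large.
Qed.
End Core.

(** * Real exponents and the homogeneous form of the one-variable inequality *)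

Section PowR.
Variable R : realType.
Implicit Types x y al : R.

Lemma powR_young x y al : 0 <= x -> 0 <= y -> 0 < al < 1 ->
  x `^ al * y `^ (1 - al) <= al * x + (1 - al) * y.
Proof.
move=> x0 y0 /andP[a0 a1].
have h := @conjugate_powR R (x `^ al) (y `^ (1 - al)) al^-1 (1 - al)^-1.
have := h (powR_ge0 _ _) (powR_ge0 _ _); rewrite !invr_gt0 !invrK.
rewrite subr_gt0 => /(_ a0 a1); rewrite subrKC => /(_ erefl).
rewrite -!powRrM !mulfV ?powRr1 ?subr_eq0 ?gt_eqF //.
by rewrite [al * x]mulrC [(1 - al) * y]mulrC.
Qed.

Lemma powR_hoelder (J : finType) (P : pred J) (p n : J -> R) (X Y al : R) :
  0 < al < 1 -> (forall j, 0 <= p j) -> (forall j, 0 <= n j) -> 0 < X -> 0 < Y ->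
  \sum_(j | P j) p j <= X -> \sum_(j | P j) n j <= Y ->
  \sum_(j | P j) p j `^ al * n j `^ (1 - al) <= X `^ al * Y `^ (1 - al).
Proof.
move=> al01 p0 n0 X0 Y0 pX nY; have [a0 a1] := andP al01.
set W := X `^ al * Y `^ (1 - al).
have W0 : 0 <= W by rewrite mulr_ge0 ?powR_ge0.
have h j : p j `^ al * n j `^ (1 - al) <=
    W * (al * (p j / X) + (1 - al) * (n j / Y)).
  have -> : p j `^ al * n j `^ (1 - al) =
      W * ((p j / X) `^ al * (n j / Y) `^ (1 - al)).
    have e1 : p j `^ al = X `^ al * (p j / X) `^ al.
      by rewrite -powRM ?divr_ge0 ?(ltW X0) // mulrC divfK // gt_eqF.
    have e2 : n j `^ (1 - al) = Y `^ (1 - al) * (n j / Y) `^ (1 - al).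
      by rewrite -powRM ?divr_ge0 ?(ltW Y0) // mulrC divfK // gt_eqF.
    by rewrite e1 e2 /W; ring.
  by rewrite ler_wpM2l // powR_young ?divr_ge0 // ltW.
apply: le_trans (ler_sum _ (fun j _ => h j)) _.
rewrite -mulr_sumr -[leRHS]mulr1 ler_wpM2l // big_split /= -!mulr_sumr -!mulr_suml.
have h1 : (\sum_(j | P j) p j) / X <= 1 by rewrite ler_pdivrMr // mul1r.
have h2 : (\sum_(j | P j) n j) / Y <= 1 by rewrite ler_pdivrMr // mul1r.
have h3 := ler_wpM2l (ltW a0) h1.
have h4 : (1 - al) * ((\sum_(j | P j) n j) / Y) <= (1 - al) * 1.
  by rewrite ler_wpM2l // subr_ge0 ltW.
by lra.
Qed.
End PowR.

(** The requirement that [s] be large in terms of [kap] and [H]; the witness [s1] is the auxiliary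
    length of the one-variable argument. *)
Definition admissible (R : realType) (kap H : R) (s : nat) : Prop :=
  exists s1 : nat, let S : R := (2 * s)%:R in let S1 : R := (2 * s1)%:R in
  [/\ 4 * kap <= S /\ 32 <= S, kap * (ln H + 4 * ln S) <= S / 2,
      (0 < s1 <= s)%N, 4 * kap * (1 + 2 * (ln H + 4 * ln S)) <= S1
    & 4 * kap * (1 + 2 * ln (6 * H * S1)) <= ln S / 2].

Section Star.
Variables (R : realType) (J : finType) (iota : J -> int) (kap H : R) (s : nat).
Hypotheses (iota_inj : injective iota) (kap_gt0 : 0 < kap) (H_ge1 : 1 <= H)
  (adm : admissible kap H s).
Local Notation E := (@energy R J unit (fun j _ => iota j)).
Let al : R := kap / (2 * s)%:R.

Let al01 : 0 < al <= 1 / 4.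
Proof.
have [s1 [[k4 S32] _ _ _ _]] := adm.
have S0 : 0 < (2 * s)%:R :> R by apply: lt_le_trans S32.
by rewrite /al divr_gt0 // ler_pdivrMr //; lra.
Qed.

(** Take [j0] maximising the coefficient and let [eta] be the mass of [n] elsewhere. Young at [j0]
    gives c_{j0} <= 1 - (1 - al) eta. Hoelder on the rest gives b <= H^al eta^{1 - al}. These are
    the inputs of [one_dim_core]. *)
Lemma one_dim_normalized (p n : J -> R) :
  (forall j, 0 <= p j <= 1) -> (forall j, 0 <= n j) ->
  \sum_j n j = 1 -> \sum_j p j <= H ->
  E s (fun j => p j `^ al * n j `^ (1 - al)) <= 1.
Proof.
move=> p01 n0 sn sp; have [a0 a4] := andP al01.
have al1 : 0 < al < 1 by rewrite a0 /=; lra.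
pose c j := p j `^ al * n j `^ (1 - al); rewrite -/c.
have [j1 _] : exists j1 : J, true.
  have [j1 _|J0] := pickP (fun _ : J => true); first by exists j1.
  by move: sn; rewrite big1 => [/eqP|j]; [rewrite eq_sym oner_eq0 | have := J0 j].
pose j0 := [arg max_(j > j1) c j]%O.
have c_max j : c j <= c j0 by rewrite /j0; case: arg_maxP => // i _ /(_ j isT).
have c_ge0 j : 0 <= c j by rewrite mulr_ge0 ?powR_ge0.
have p0 j : 0 <= p j by have /andP[] := p01 j.
have n_sum : n j0 + \sum_(j | j != j0) n j = 1 by rewrite -sn [RHS](bigD1 j0).
have rest_ge0 : 0 <= \sum_(j | j != j0) n j by apply: sumr_ge0.
have sp' : \sum_(j | j != j0) p j <= H.
  by apply: le_trans sp; rewrite [leRHS](bigD1 j0) //= lerDr.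
have [s1 [[k4 S32] h2 h3 h4 h5]] := adm.
pose eta := \sum_(j | j != j0) n j.
apply: (@one_dim_core R J iota iota_inj kap H _ _ s s1 erefl erefl kap_gt0 k4 H_ge1
  S32 h2 h3 h4 h5 c j0 eta) => //.
- by rewrite rest_ge0 /=; have := n0 j0; rewrite /eta; lra.
- apply: le_trans (powR_young (p0 j0) (n0 j0) al1) _.
  have /andP[_ pj] := p01 j0.
  have : al * p j0 <= al * 1 by rewrite ler_pM2l.
  have -> : n j0 = 1 - eta by rewrite -n_sum /eta; ring.
  rewrite -/al; lra.
- move=> eta0; rewrite big1 // => j jj0.
  have nj : n j = 0.
    by have /psumr_eq0P := eta0; apply.
  by rewrite /c nj powR0 ?mulr0 // gt_eqF //; lra.
- move=> eta0; rewrite -/al.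
  have := powR_hoelder al1 p0 n0 (lt_le_trans ltr01 H_ge1) eta0 sp' (lexx _).
  rewrite -/eta => /le_trans; apply.
  have H0 : 0 < H by apply: lt_le_trans H_ge1.
  have e : eta = expR (ln eta) by rewrite lnK.
  rewrite /powR !gt_eqF // [X in _ <= X * _]e -!expRD ler_expR.
  by lra.
Qed.

Lemma one_dim_energy (p n : J -> R) (P N : R) : 0 < P -> 0 < N ->
  (forall j, 0 <= p j <= P) -> (forall j, 0 <= n j) ->
  \sum_j n j = N -> \sum_j p j <= H * P ->
  E s (fun j => p j `^ al * n j `^ (1 - al)) <= (P `^ al * N `^ (1 - al)) ^+ (2 * s).
Proof.
move=> P0 N0 pP n0 sn sp.
have -> : (fun j => p j `^ al * n j `^ (1 - al)) = (fun j =>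
    (P `^ al * N `^ (1 - al)) * ((p j / P) `^ al * (n j / N) `^ (1 - al))).
  apply/funext => j; have /andP[p0 _] := pP j.
  have e1 : p j `^ al = P `^ al * (p j / P) `^ al.
    by rewrite -powRM ?divr_ge0 ?(ltW P0) // mulrC divfK // gt_eqF.
  have e2 : n j `^ (1 - al) = N `^ (1 - al) * (n j / N) `^ (1 - al).
    by rewrite -powRM ?divr_ge0 ?(ltW N0) // mulrC divfK // gt_eqF.
  by rewrite e1 e2; ring.
rewrite energy_scale -[leRHS]mulr1 ler_wpM2l //.
  by rewrite exprn_ge0 // mulr_ge0 ?powR_ge0.
apply: one_dim_normalized.
- by move=> j; have /andP[p0 p1] := pP j; rewrite divr_ge0 ?(ltW P0) //= ler_pdivrMr // mul1r.
- by move=> j; rewrite divr_ge0 // ltW.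
- by rewrite -mulr_suml sn divff // gt_eqF.
- by rewrite -mulr_suml ler_pdivrMr.
Qed.
End Star.

(** * Query complexity *)

(* Leaves keep up to two elements, since valuations do not see the sign. *)
Inductive query (T : finType) (num : T -> int) : nat -> {set T} -> Prop :=
| query_leaf D (A : {set T}) : (#|A| <= 2)%N -> query num D A
| query_node D p (A : {set T}) : prime p ->
    (forall v : nat, query num D [set a in A | logn p `|num a| == v]) ->
    query num D.+1 A.

Definition ind (R : realDomainType) (T : finType) (A : {set T}) (a : T) : R :=
  (a \in A)%:R.

Lemma ind_ge0 (R : realDomainType) (T : finType) (A : {set T}) (a : T) :
  0 <= ind R A a.
Proof. by rewrite /ind ler0n. Qed.

Lemma sum_ind (R : realDomainType) (T : finType) (A : {set T}) :
  \sum_a ind R A a = #|A|%:R.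
Proof. by rewrite /ind -natr_sum -sum1_card [in RHS]big_mkcond. Qed.

Lemma int_abs_inj (m n : int) : m != 0 -> n != 0 ->
  `|m|%N = `|n|%N -> (0 < m) = (0 < n) -> m = n.
Proof.
case: m => m; case: n => n //= m0 n0.
- by move=> ->.
- by move=> ->.
- by move=> <-.
- by move=> [->].
Qed.

Section Tree.
Variables (R : realType) (T : finType) (num : T -> int) (M : nat).
Hypotheses (num_inj : injective num) (num_neq0 : forall a, num a != 0)
  (num_lt : forall a, (`|num a| < M)%N).
Variables (kap H : R) (s : nat).
Hypotheses (kap_gt0 : 0 < kap) (H_ge1 : 1 <= H) (adm : admissible kap H s).
Let al : R := kap / (2 * s)%:R.

(** All indices below [M] serve as coordinates. Non-prime ones contribute 0, and every prime
    dividing some [num a] is below [M]. *)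
Definition valuation (a : T) (i : 'I_M) : int := (logn i `|num a|)%:Z.

Let H_gt0 : 0 < H. Proof. exact: lt_le_trans H_ge1. Qed.

Let s_gt0 : (0 < s)%N.
Proof. by have [s1 [_ _ /andP[h1 h2] _ _]] := adm; apply: leq_trans h2. Qed.

Let al_gt0 : 0 < al.
Proof. by rewrite divr_gt0 // ltr0n muln_gt0. Qed.

Let al_lt1 : al < 1.
Proof.
have [s1 [[k4 S32] _ _ _ _]] := adm.
by rewrite ltr_pdivrMr ?ltr0n ?muln_gt0 // mul1r; move: (kap_gt0) => ?; lra.
Qed.

Let E := energy (R := R) valuation s.

Lemma logn_lt p a : (logn p `|num a| < M)%N.
Proof. by apply: ltn_trans (num_lt a); rewrite ltn_logl // absz_gt0. Qed.

(** What the induction carries about the weight psi(A): its size, the sets of low query complexity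
    that it guarantees at every depth [D], and its control of the multiplicative energy. *)
Definition tree_bound (A : {set T}) (psi : R) : Prop :=
  [/\ 0 <= psi <= #|A|%:R, (0 < #|A|)%N -> 0 < psi,
      forall D, exists2 A' : {set T}, A' \subset A &
        query num D A' /\ psi <= #|A'|%:R + H ^- D * #|A|%:R
    & E (ind R A) <= (psi `^ al * #|A|%:R `^ (1 - al)) ^+ (2 * s)].

(** Induction on the number of valuations that may still vary on [A]. At a prime [n] the set is
    split by its n-adic valuation, and the energy clause is carried over by the one-variable
    inequality. *)
Lemma tree_bound_exists n (A : {set T}) : (n <= M)%N ->
  (forall i : 'I_M, (n <= i)%N -> {in A &, forall a b, valuation a i = valuation b i}) ->
  exists psi, tree_bound A psi.
Proof.
elim: n A => [|n IH] A nM const.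
  have card2 : (#|A| <= 2)%N.
    pose sgv a := 0 < num a.
    have sgv_inj : {in A &, injective sgv}.
      (* When all valuations agree on [A], its elements share one absolute value, so only the sign
         distinguishes them. *)
      move=> a b aA bA e; apply: num_inj.
      have eqabs : `|num a|%N = `|num b|%N.
        apply: eqn_from_log; rewrite ?absz_gt0 // => p.
        have [pM|Mp] := ltnP p M.
          by have [] := const (Ordinal pM) isT a b aA bA.
        have log0 c : logn p `|num c| = 0%N.
          by rewrite lognE gtnNdvd ?absz_gt0 ?(leq_trans (num_lt c)) ?andbF.
        by rewrite !log0.
      exact: (int_abs_inj (num_neq0 a) (num_neq0 b) eqabs e).
    by rewrite -(card_in_imset sgv_inj) -card_bool max_card.
  exists #|A|%:R; split=> //.
  - by rewrite lexx ler0n.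
  - by rewrite ltr0n.
  - move=> D; exists A => //; split; first exact: query_leaf.
    by rewrite lerDl mulr_ge0 // invr_ge0 exprn_ge0 // ltW.
  - rewrite -powRD; last by rewrite addrC subrK oner_eq0.
    rewrite subrKC powRr1 // -(sum_ind R).
    by apply: energy_le_total => a; apply: ind_ge0.
have [nprime|npr] := boolP (prime n); last first.
  apply: IH => [|i ni a b aA bA]; first exact: ltnW.
  move: ni; rewrite leq_eqVlt => /predU1P[ni|ni]; last exact: const.
  have log0 m : logn n m = 0%N by rewrite lognE (negPf npr).
  by rewrite /valuation -ni !log0.
pose i0 : 'I_M := Ordinal nM.
pose f a : 'I_M := Ordinal (logn_lt n a).
pose Av (v : 'I_M) : {set T} := [set a in A | f a == v].
have sumAv : \sum_v #|Av v|%:R = #|A|%:R :> R.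
  rewrite -natr_sum; congr _%:R.
  rewrite -[RHS]sum1_card (partition_big f predT) //=; apply: eq_bigr => v _.
  by rewrite -sum1_card; apply: eq_bigl => a; rewrite inE.
have /choice[F FP] : forall v, exists psi, tree_bound (Av v) psi.
  move=> v; apply: IH => [|i ni a b].
    exact: ltnW.
  rewrite !inE => /andP[aA /eqP fa] /andP[bA /eqP fb].
  move: ni; rewrite leq_eqVlt => /predU1P[ni|ni]; last exact: const.
  by rewrite /valuation -ni; have := congr1 (@nat_of_ord M) (etrans fa (esym fb)) => /= ->.
have F0 v : 0 <= F v by have [/andP[]] := FP v.
have FA v : F v <= #|Av v|%:R by have [/andP[]] := FP v.
pose v0 := [arg max_(v > i0) F v]%O.
have F_max v : F v <= F v0 by rewrite /v0; case: arg_maxP => // i _ /(_ v isT).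
pose P := Num.max (F v0) ((\sum_v F v) / H).
have F_P v : F v <= P by rewrite le_max F_max.
have sF_P : \sum_v F v <= H * P.
  by rewrite mulrC -ler_pdivrMr // le_max lexx orbT.
have sF_A : \sum_v F v <= #|A|%:R by rewrite -sumAv; apply: ler_sum.
have P0 : 0 <= P by apply: le_trans (F0 v0) (F_P v0).
have P_gt0 : (0 < #|A|)%N -> 0 < P.
  move=> /card_gt0P[a aA]; apply: lt_le_trans (F_P (f a)).
  have [_ + _ _] := FP (f a); apply; apply/card_gt0P; exists a.
  by rewrite inE aA /=.
exists P; split=> //.
- rewrite P0 /= ge_max; apply/andP; split.
    apply: le_trans (FA v0) _; rewrite ler_nat; apply: subset_leq_card.
    by apply/fintype.subsetP => a; rewrite inE => /andP[].
  rewrite ler_pdivrMr //; apply: le_trans sF_A _.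
  by rewrite ler_peMr // ler0n.
- move=> D; have HD : 0 < H ^- D by rewrite invr_gt0 exprn_gt0.
  have [e|e] : P = F v0 \/ P = (\sum_v F v) / H.
    by rewrite /P maxEle; case: ifP; [right | left].
  (* If the maximum is one fibre, its subset is kept and no query is spent. *)
  - have [_ _ /(_ D)[A' sA' [qA' bA']] _] := FP v0.
    have sub : Av v0 \subset A by apply/fintype.subsetP => a; rewrite inE => /andP[].
    exists A'; first exact: fintype.subset_trans sub.
    split=> //; rewrite e; apply: le_trans bA' _.
    by rewrite lerD2l ler_pM2l // ler_nat subset_leq_card.
  (* If the maximum is the average, one query is spent. For depth 0 the empty set suffices, as psi
     <= #|A|. Otherwise the subsets of all fibres at depth [D] are glued, and division by [H] turns
     the error H^{-D} into H^{-(D+1)}. *)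
  - case: D HD => [|D] HD.
      exists finset.set0; first exact: finset.sub0set.
      split; first by apply: query_leaf; rewrite cards0.
      rewrite cards0 add0r expr0 invr1 mul1r e ler_pdivrMr //.
      by apply: le_trans sF_A _; rewrite ler_peMr // ler0n.
    have /choice[G GP] : forall v, exists G : {set T}, G \subset Av v /\
        (query num D G /\ F v <= #|G|%:R + H ^- D * #|Av v|%:R).
      move=> v; by have [_ _ /(_ D)[A' sA' qA'] _] := FP v; exists A'.
    pose A' := [set a | a \in G (f a)].
    have GA' (v : 'I_M) : [set a in A' | logn n `|num a| == v] = G v.
      apply/finset.setP => a; rewrite !inE.
      have [fv|nfv] := eqVneq (f a) v.
        have -> : logn n `|num a| = v :> nat by rewrite -fv.
        by rewrite fv eqxx andbT.
      have -> : (logn n `|num a| == v) = false by exact: negbTE nfv.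
      rewrite andbF.
      apply/esym/negP => aG; have [/fintype.subsetP/(_ a aG) + _] := GP v.
      by rewrite inE (negPf nfv) andbF.
    exists A'.
      apply/fintype.subsetP => a; rewrite inE => aG.
      have [/fintype.subsetP/(_ a aG) + _] := GP (f a).
      by rewrite inE => /andP[].
    split.
      apply: (query_node nprime) => v; have [vM|Mv] := ltnP v M.
        by rewrite (GA' (Ordinal vM)); have [_ []] := GP (Ordinal vM).
      apply: query_leaf; rewrite (_ : [set _ in _ | _] = finset.set0) ?cards0 //.
      apply/finset.setP => a; rewrite !inE; apply/negbTE/negP => /andP[_ /eqP lv].
      by have := logn_lt n a; rewrite lv ltnNge Mv.
    have cA' : #|A'|%:R = \sum_v #|G v|%:R :> R.
      rewrite -natr_sum; congr _%:R.
      rewrite -[LHS]sum1_card (partition_big f predT) //=; apply: eq_bigr => v _.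
      by rewrite -sum1_card -GA'; apply: eq_bigl => a; rewrite !inE.
    rewrite e ler_pdivrMr //.
    have h : \sum_v F v <= \sum_v (#|G v|%:R + H ^- D * #|Av v|%:R).
      by apply: ler_sum => v _; have [_ []] := GP v.
    apply: le_trans h _; rewrite big_split /= -mulr_sumr -cA' sumAv mulrDl.
    have -> : H ^- D.+1 * #|A|%:R * H = H ^- D * #|A|%:R.
      by rewrite exprS invfM; field; rewrite expf_neq0 ?gt_eqF.
    by rewrite lerD2r ler_peMr.
- have [A0|A_gt0] := posnP #|A|.
    apply: le_trans (energy_le_total _ _ _) _; first exact: ind_ge0.
    rewrite sum_ind A0; rewrite expr0n muln_eq0 (gtn_eqF s_gt0) /=.
    by rewrite exprn_ge0 // mulr_ge0 ?powR_ge0.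
  have iota_inj : injective (fun v : 'I_M => v%:Z) by move=> u v [] /ord_inj.
  apply: le_trans (@energy_fibers _ _ _ _ _ i0 _ (fun v : 'I_M => v%:Z) f _
     (fun v => F v `^ al * #|Av v|%:R `^ (1 - al)) s_gt0 _ _ _ _) _.
  - exact: ind_ge0.
  - by [].
  - by move=> v; rewrite mulr_ge0 ?powR_ge0.
  - move=> v; have [_ _ _] := FP v.
    rewrite /E (_ : ind R (Av v) = fun a => if f a == v then ind R A a else 0) //.
    by apply/funext => a; rewrite /ind inE; case: (f a == v); rewrite ?andbT ?andbF.
  apply: (@one_dim_energy R 'I_M _ kap H s iota_inj kap_gt0 H_ge1 adm) => //.
  - exact: P_gt0.
  - by rewrite ltr0n.
  - by move=> v; rewrite F0 F_P.
Qed.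
End Tree.

Lemma energy_union (R : rcfType) (T I : finType) (phi : T -> I -> int) t
    (A B : {set T}) (a b : R) : (0 < t)%N -> [disjoint A & B] -> 0 <= a -> 0 <= b ->
  energy phi t (ind R A) <= a ^+ (2 * t) -> energy phi t (ind R B) <= b ^+ (2 * t) ->
  energy phi t (ind R (A :|: B)) <= (a + b) ^+ (2 * t).
Proof.
move=> t0 dAB a0 b0 eA eB.
have -> : a + b = \sum_(i : bool) 1 * (if i then a else b) by rewrite big_bool !mul1r.
apply: (@energy_triangle _ _ _ _ _ _ (fun=> 1) _
          (fun i : bool => if i then ind R A else ind R B)) => //.
- move=> x; rewrite big_bool /= !mul1r /ind inE.
  have := disjointFr dAB (x := x).
  by case: (x \in A) => [/(_ isT)->|_] /=; rewrite ?addr0 ?add0r.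
- by case.
- by case.
Qed.

(** * Additive energy of sets of small query complexity *)

Section QueryEnergy.
Variables (R : realType) (T : finType) (num : T -> int).
Hypothesis num_neq0 : forall a, num a != 0.
Let E t := @energy R T unit (fun a _ => num a) t.

(** If the minimal valuation occurred only once, every other term would be divisible by a higher
    power of [p], and by the relation so would the minimal one. *)
Lemma balanced_min_valuation t p (u : {ffun slot t -> T}) : (0 < t)%N -> prime p ->
  balanced (fun a (_ : unit) => num a) u ->
  exists k k', k != k' /\ logn p `|num (u k)| = logn p `|num (u k')|.
Proof.
move=> t0 pr /forallP/(_ tt)/eqP bal; pose k0 : slot t := (true, Ordinal t0).
pose k := [arg min_(k < k0) logn p `|num (u k)|%N].
have k_min k' : (logn p `|num (u k)| <= logn p `|num (u k')|)%N.
  by rewrite /k; case: arg_minnP => // i _ /(_ k' isT).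
have [/existsP[k' /andP[kk' /eqP e]]|] :=
  boolP [exists k', (k != k') && (logn p `|num (u k)| == logn p `|num (u k')|)].
  by exists k, k'.
rewrite negb_exists => /forallP nk.
pose d := (p ^ (logn p `|num (u k)|).+1)%N.
have d_dvd k' : k' != k -> (d%:Z %| slot_sign k'.1 * num (u k'))%Z.
  move=> kk'; apply: dvdz_mull; rewrite dvdzE /= pfactor_dvdn ?absz_gt0 //.
  by have := nk k'; rewrite eq_sym kk' /= ltn_neqAle k_min => ->.
have : (d%:Z %| slot_sign k.1 * num (u k))%Z.
  move: bal; rewrite (bigD1 k) //= => /eqP; rewrite addr_eq0 => /eqP ->.
  rewrite dvdzE abszN -dvdzE.
  by elim/big_ind: _ => [|x y dx dy|k' kk']; [exact: dvdz0 | exact: rpredD | exact: d_dvd].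
rewrite dvdzE abszM (_ : `|slot_sign k.1|%N = 1%N) ?mul1n; last by case: k.1.
by rewrite pfactor_dvdn ?absz_gt0 // ltnn.
Qed.

(** Every solution has two slots in a common fibre. Summing over the pair of slots and the fibre,
    Hoelder gives n_v^2 N^{2t-2} for each choice, with at most (2t)^2 pairs. *)
Lemma energy_valuation_fibers t p (A : {set T}) (V : nat) (n : 'I_V -> R) (N : R) :
  (0 < t)%N -> prime p -> (forall a, logn p `|num a| < V)%N ->
  (forall v, 0 <= n v) -> 0 <= N ->
  (forall v : 'I_V, E t (ind R [set a in A | logn p `|num a| == v]) <= n v ^+ (2 * t)) ->
  E t (ind R A) <= N ^+ (2 * t) ->
  E t (ind R A) <= (2 * t)%:R ^+ 2 * (\sum_v n v ^+ 2) * N ^+ (2 * t).-2.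
Proof.
move=> t0 pr ltV n0 N0 en eN.
pose Av (v : 'I_V) : {set T} := [set a in A | logn p `|num a| == v].
pose c (w : slot t * slot t * 'I_V) (k : slot t) : T -> R :=
  if (k == w.1.1) || (k == w.1.2) then ind R (Av w.2) else ind R A.
have c0 w k a : 0 <= c w k a by rewrite /c; case: ifP => _; apply: ind_ge0.
apply: (@le_trans _ _ (\sum_(w | w.1.1 != w.1.2) wsum (fun a (_ : unit) => num a) (c w))).
  rewrite /E /energy /wsum exchange_big /=; apply: ler_sum => u bal.
  have [/forallP uA|] := boolP [forall k, u k \in A]; last first.
    rewrite negb_forall => /existsP[k /negPf uk].
    rewrite (bigD1 k) //= /ind uk mul0r; apply: sumr_ge0 => w _.
    by apply: prodr_ge0.
  have [k [k' [kk' e]]] := balanced_min_valuation t0 pr bal.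
  pose w := (k, k', Ordinal (ltV (u k))).
  rewrite (bigD1 w) //= big1 => [|i _]; last by rewrite /ind uA.
  rewrite big1 => [|i _].
    by rewrite lerDl; apply: sumr_ge0 => w' _; apply: prodr_ge0.
  rewrite /c /w /=; case: ifP => [/orP[]/eqP ->|_]; rewrite /ind ?uA // inE uA /=.
    by rewrite eqxx.
  by rewrite -e eqxx.
have t2 : (2 <= 2 * t)%N by rewrite leq_pmulr.
apply: (@le_trans _ _ (\sum_(w : slot t * slot t * 'I_V | w.1.1 != w.1.2)
   n w.2 ^+ 2 * N ^+ (2 * t).-2)).
  apply: ler_sum => -[[k k'] v] /= kk'.
  pose Nk (j : slot t) := if (j == k) || (j == k') then n v else N.
  apply: le_trans (wsum_holder (N := Nk) t0 _ _) _.
  - by move=> j; rewrite /Nk; case: ifP.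
  - by move=> j; rewrite /c /Nk /=; case: ifP => _; [exact: en | exact: eN].
  rewrite (bigD1 k) //= (bigD1 k') //= 1?eq_sym // /Nk !eqxx orbT mulrA -expr2.
  rewrite (eq_bigr (fun=> N)); last first.
    by move=> j /andP[/negPf -> /negPf ->].
  rewrite prodr_const.
  have := cardD1 k' (predC1 k); rewrite cardC1 card_slot !inE eq_sym kk' add1n.
  move=> /(congr1 predn) /= ->.
  by rewrite (eq_card (B := [predD1 predC1 k & k'])) // => j; rewrite !inE andbC.
apply: (@le_trans _ _ (\sum_(w : slot t * slot t * 'I_V) n w.2 ^+ 2 * N ^+ (2 * t).-2)).
  rewrite [leRHS](bigID (fun w => w.1.1 != w.1.2)) /= lerDl; apply: sumr_ge0 => w _.
  by rewrite mulr_ge0 ?exprn_ge0.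
rewrite -(pair_bigA _ (fun _ v => n v ^+ 2 * N ^+ (2 * t).-2)) /= sumr_const.
by rewrite card_prod !card_slot -mulr_suml expr2 -natrM -mulrA mulr_natl.
Qed.

(** Write the energy as N^{2t}. The fibre bound and division by N^{2t-2} give N^2 <= H sum_v n_v^2.
    This is additive in the fibres, so their sizes add up to #|A| and a query costs exactly one
    factor [H]. *)
Lemma query_energy t D (A : {set T}) : (0 < t)%N -> query num D A ->
  E t (ind R A) <= (((2 * t)%:R ^+ 2) ^+ D * (2 * #|A|%:R)) ^+ t.
Proof.
move=> t0; set H := (2 * t)%:R ^+ 2.
have H1 : 1 <= H :> R by rewrite exprn_ege1 // ler1n muln_gt0.
have H0 : 0 < H :> R by apply: lt_le_trans H1.
elim=> {D A} [D A A2|D p A pr _ IH].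
  apply: le_trans (energy_le_total _ _ (@ind_ge0 R T A)) _.
  rewrite sum_ind exprM; apply: lerXn2r; rewrite ?nnegrE ?exprn_ge0 //.
    by rewrite mulr_ge0 ?exprn_ge0 ?mulr_ge0 // ltW.
  apply: le_trans (_ : 1 * (2 * #|A|%:R) <= _); last first.
    by rewrite ler_wpM2r ?mulr_ge0 // exprn_ege1.
  by rewrite mul1r expr2 ler_wpM2r // ler_nat.
pose V := (\max_a logn p `|num a|).+1.
have ltV a : (logn p `|num a| < V)%N by rewrite ltnS (leq_bigmax a).
pose Av (v : 'I_V) : {set T} := [set a in A | logn p `|num a| == v].
pose n v := Num.sqrt (H ^+ D * (2 * #|Av v|%:R)).
have n2 v : n v ^+ 2 = H ^+ D * (2 * #|Av v|%:R).
  by rewrite sqr_sqrtr // mulr_ge0 ?exprn_ge0 ?mulr_ge0 // ltW.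
have E0 : 0 <= E t (ind R A) by apply: energy_ge0 => a; apply: ind_ge0.
pose N := E t (ind R A) `^ ((2 * t)%:R^-1).
have NE : N ^+ (2 * t) = E t (ind R A).
  rewrite -powR_mulrn ?powR_ge0 // -powRrM mulVf ?powRr1 //.
  by rewrite pnatr_eq0 muln_eq0 (gtn_eqF t0).
have N0 : 0 <= N by apply: powR_ge0.
have h : E t (ind R A) <= H * (\sum_v n v ^+ 2) * N ^+ (2 * t).-2.
  apply: (energy_valuation_fibers t0 pr ltV) => //; last by rewrite NE.
    by move=> v; apply: sqrtr_ge0.
  by move=> v; rewrite exprM n2; apply: IH.
have sn : \sum_v n v ^+ 2 = H ^+ D * (2 * #|A|%:R).
  under eq_bigr do rewrite n2.
  rewrite -!mulr_sumr; congr (_ * (_ * _)); rewrite -natr_sum; congr _%:R.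
  rewrite -[RHS]sum1_card (partition_big (fun a => Ordinal (ltV a)) predT) //=.
  by apply: eq_bigr => v _; rewrite -sum1_card; apply: eq_bigl => a; rewrite inE.
rewrite sn mulrA -exprS in h.
rewrite -NE exprM; apply: lerXn2r; rewrite ?nnegrE ?exprn_ge0 //.
  by rewrite mulr_ge0 ?exprn_ge0 ?mulr_ge0 // ltW.
have [->|Nn0] := eqVneq N 0.
  by rewrite expr0n /= mulr_ge0 ?exprn_ge0 ?mulr_ge0 // ltW.
have NP : 0 < N by rewrite lt_def Nn0.
rewrite -(ler_pM2r (_ : 0 < N ^+ (2 * t).-2)) ?exprn_gt0 // -exprD.
rewrite (_ : (2 + (2 * t).-2 = 2 * t)%N) ?NE //.
by case: (t) t0 => // m _; rewrite mulnS.
Qed.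
End QueryEnergy.

(** * Admissibility of explicit parameters *)

Lemma sqr_le_expn2 n : (n ^ 2 <= 2 ^ n.+1)%N.
Proof.
case: n => [|[|[|n]]] //; elim: n => // n IH.
rewrite expnS; apply: leq_trans (leq_mul (leqnn 2) IH).
by rewrite !expnS !expn0; nia.
Qed.

Lemma ln2_bounds (R : realType) : 1 / 2 <= ln 2 :> R /\ ln 2 <= 1 :> R.
Proof.
split.
  rewrite -ler_expR lnK ?posrE //.
  by apply: le_trans (_ : 1 + 2 * (1 / 2) <= 2); [apply: expR_le1D2x|]; lra.
rewrite (_ : 2 = 1 + 1) //; apply: le_ln1Dx; lra.
Qed.

Lemma admissible_large (R : realType) (q k m : nat) : (2 <= q)%N -> (0 < k)%N ->
  ((100 * (q * k)) ^ 3 <= m)%N ->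
  admissible (4 * k%:R : R) (q%:R ^+ 2) (2 ^ m).
Proof.
(* With X = qk this makes S1 = 80 X m, while log S is of order m. The condition on [S1] costs at
   most 64 X m + 8 X (4 X + 9), which fits because m is at least (100 X)^3. *)
move=> q2 k0 hm; exists (40 * (q * k) * m)%N => S S1.
pose X : R := (q * k)%:R; pose mm : R := m%:R.
have X2 : 2 <= X by rewrite ler_nat; apply: leq_trans q2 _; rewrite leq_pmulr.
have mX : (100 * 100 * 100) * (X * (X * X)) <= mm.
  rewrite (_ : _ * (X * (X * X)) = (100 * X) ^+ 3); last by ring.
  by rewrite /X /mm -natrM -natrX ler_nat.
have X1 : 4 <= X * X by nra.
have X3 : 4 * X <= X * (X * X) by nra.
have XX3 : 2 * (X * X) <= X * (X * X) by nra.
have SE : S = 2 ^+ m.+1 by rewrite /S -natrX expnS.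
have S0 : 0 < S by rewrite SE exprn_gt0.
have Sm : mm * mm <= S by rewrite SE -natrX -natrM ler_nat mulnn sqr_le_expn2.
have S1E : S1 = 80 * X * mm by rewrite /S1 /X /mm !natrM; ring.
have lnSE : ln S = (mm + 1) * ln 2 by rewrite SE lnXn // -[LHS]mulr_natl -[m.+1]addn1 natrD.
have [l1 l2] := ln2_bounds R.
have lnS_le : ln S <= mm + 1 by rewrite lnSE -[leRHS]mulr1 ler_wpM2l // addr_ge0.
have lnS_ge : (mm + 1) / 2 <= ln S.
  by rewrite lnSE ler_wpM2l ?addr_ge0 //; lra.
have q0 : 0 < q%:R :> R by rewrite ltr0n; apply: leq_trans q2.
have qX : q%:R <= X by rewrite ler_nat leq_pmulr.
have kX : 2 * k%:R <= X by rewrite -natrM ler_nat leq_mul2r q2 orbT.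
have k1 : 1 <= k%:R :> R by rewrite ler1n.
have lnH : ln (q%:R ^+ 2) <= 2 * X.
  rewrite lnXn // -[leLHS]mulr_natl ler_pM2l //; apply: le_trans qX.
  by apply: ltW; apply: ln_sublinear.
have lnH0 : 0 <= ln (q%:R ^+ 2 : R).
  by apply: ln_ge0; rewrite exprn_ege1 // ler1n; apply: leq_trans q2.
have mm0 : (100 * 100 * 100) <= mm by lra.
have Xmm : X * mm <= mm * mm / (100 * 100 * 100).
  have : ((100 * 100 * 100) * X) * mm <= mm * mm by rewrite ler_wpM2r //; lra.
  by lra.
have mmm : (100 * 100 * 100) * mm <= mm * mm by rewrite ler_wpM2r //; lra.
have lnS0 : 0 <= ln S by move: lnS_ge mm0; clear; lra.
have kap0 : 0 <= 4 * k%:R :> R by lra.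
have kapX : 4 * k%:R <= 2 * X by lra.
have c1 : 4 * k%:R * (ln (q%:R ^+ 2) + 4 * ln S) <= 2 * X * (2 * X + 4 * (mm + 1)).
  move: kap0 kapX lnH lnH0 lnS_le lnS0 X2 mm0; clear => *.
  by apply: ler_pM => //; lra.
split.
- by split; [lra | move: mm0 mmm Sm; clear; lra].
- by apply: le_trans c1 _; move: X2 mX XX3 X3 Xmm mmm Sm; clear; lra.
- rewrite !muln_gt0 k0 (leq_trans _ q2) // (leq_trans _ hm) /=; last first.
    by rewrite expn_gt0 !muln_gt0 k0 (leq_trans _ q2).
  rewrite -(ler_nat R) natrM.
  have -> : (2 ^ m)%:R = S / 2 by rewrite /S natrM mulrAC divff ?mul1r.
  rewrite natrM -/X -/mm; move: Xmm Sm mmm mm0; clear; lra.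
- rewrite S1E; apply: le_trans (_ : 4 * (2 * X) * (1 + 2 * (2 * X + 4 * (mm + 1))) <= _).
    move: kap0 kapX lnH lnH0 lnS_le lnS0 X2 mm0; clear => *.
    by apply: ler_pM => //; lra.
  have : X * (4 * X + 9) <= X * (2 * mm).
    by rewrite ler_wpM2l //; move: X2 X3 mX; clear; lra.
  by move: X2 mm0; clear; lra.
- have mmp : 0 < mm by apply: lt_le_trans mm0; rewrite !mulr_gt0.
  have Xp : 0 < X by apply: lt_le_trans X2.
  have mX480 : 480 * (X * (X * X)) <= mm by move: mX X3 X2; clear; lra.
  have mX300 : (300 * X) * (300 * X) <= mm by move: mX XX3 X1; clear; lra.
  have arg_le : 6 * q%:R ^+ 2 * S1 <= mm * mm.
    rewrite S1E; apply: (@le_trans _ _ (6 * (X * X) * (80 * X * mm))).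
      rewrite ler_wpM2r ?mulr_ge0 ?(ltW Xp) ?(ltW mmp) //.
      by rewrite ler_wpM2l // expr2 ler_pM // ltW.
    by have := ler_wpM2r (ltW mmp) mX480; clear; lra.
  have S10 : 0 < S1 by rewrite S1E !mulr_gt0.
  clear mX X1 X3 XX3 mX480 lnS_le lnSE l1 l2 Sm Xmm mmm c1 qX kX lnH lnH0 S1E SE hm.
  (* Since 6 H S1 <= m^2 = w^4, its logarithm is at most 4 w. As w >= 300 X, the product of X and w
     is then small against m, hence against log S. *)
  pose w := Num.sqrt mm.
  have w0 : 0 <= w by apply: sqrtr_ge0.
  have ww : w * w = mm by rewrite -expr2 sqr_sqrtr.
  have wp : 0 < w by rewrite sqrtr_gt0.
  have lnarg : ln (6 * q%:R ^+ 2 * S1) <= 4 * w.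
    apply: (@le_trans _ _ (ln (w ^+ 4))).
      rewrite ler_ln ?posrE ?exprn_gt0 // ?mulr_gt0 ?exprn_gt0 //.
      by apply: le_trans arg_le _; rewrite -ww !exprS expr0; lra.
    rewrite lnXn // -[leLHS]mulr_natl ler_pM2l //.
    by apply: ltW; apply: ln_sublinear.
  have wX : 300 * X <= w.
    rewrite leNgt; apply/negP => wX.
    have : w * w < (300 * X) * (300 * X) by apply: ltr_pM.
    by rewrite ww ltNge mX300.
  have w1 : 1 <= w by lra.
  have kap4 : 0 <= 4 * (4 * k%:R) :> R by rewrite mulr_ge0.
  apply: (@le_trans _ _ (4 * (4 * k%:R) * (9 * w))).
    by rewrite ler_wpM2l //; lra.
  apply: (@le_trans _ _ (4 * (2 * X) * (9 * w))).
    by rewrite ler_wpM2r ?mulr_ge0 //; lra.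
  have : 300 * X * w <= w * w by rewrite ler_wpM2r.
  by lra.
Qed.

(** * Decomposition *)

Section Quartic.
Variable R : realType.

(** Fourth roots suffice throughout: with kap = 4k the threshold for psi is #|A|^{3/4}, and a
    polynomial inequality replaces one in real powers. *)
Definition root4 (n : nat) : R := n%:R `^ (1 / 4).

Lemma root4_ge0 n : 0 <= root4 n. Proof. exact: powR_ge0. Qed.

Lemma root4K n : root4 n ^+ 4 = n%:R.
Proof.
rewrite -powR_mulrn ?root4_ge0 // -powRrM (_ : 1 / 4 * 4 = 1) ?powRr1 //.
by field.
Qed.

Lemma root4_le m n : (m <= n)%N -> root4 m <= root4 n.
Proof. by move=> mn; rewrite ge0_ler_powR ?nnegrE ?ler_nat // divr_ge0. Qed.

Lemma root4_gt0 n : (0 < n)%N -> 0 < root4 n.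
Proof. by move=> n0; rewrite powR_gt0 // ltr0n. Qed.

(** Used in the form (3/4)(y^4 - z^4) / y <= y^3 - z^3, a discrete derivative of n^{3/4} that makes
    the greedy sum telescope. *)
Lemma young4 (u v : R) : 4 * (u * v ^+ 3) <= u ^+ 4 + 3 * v ^+ 4.
Proof.
rewrite -subr_ge0 (_ : _ - _ = (u - v) ^+ 2 * ((u + v) ^+ 2 + 2 * v ^+ 2)); last by ring.
apply: mulr_ge0; first exact: sqr_ge0.
by apply: addr_ge0; [exact: sqr_ge0 | apply: mulr_ge0 => //; exact: sqr_ge0].
Qed.
End Quartic.

Section Decomposition.
Variables (R : realType) (T : finType) (num : T -> int) (M : nat).
Hypotheses (num_inj : injective num) (num_neq0 : forall a, num a != 0)
  (num_lt : forall a, (`|num a| < M)%N).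
Variables (k s t : nat).
Local Notation H := ((2 * t)%:R ^+ 2).
Hypotheses (k_gt0 : (0 < k)%N) (t_gt0 : (0 < t)%N)
  (adm : admissible (4 * k%:R : R) H s).
Local Notation add_E := (@energy R T unit (fun a _ => num a) t).
Local Notation mul_E := (@energy R T 'I_M (@valuation T num M) s).

Let H_ge4 : 4 <= H :> R.
Proof.
rewrite -natrX ler_nat; apply: (@leq_trans (2 ^ 2)) => //.
by rewrite leq_sqr leq_pmulr.
Qed.

(** Comparing the two bounds gives n^{2s-k} < psi^{4k} n^{2s-4k}, that is n^{3k} < psi^{4k}; then
    take k-th roots. *)
Lemma large_mul_energy_psi (A : {set T}) (psi : R) : (0 < #|A|)%N ->
  #|A|%:R ^+ (2 * s) < mul_E (ind R A) * #|A|%:R ^+ k ->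
  0 < psi -> mul_E (ind R A) <=
    (psi `^ (4 * k%:R / (2 * s)%:R) * #|A|%:R `^ (1 - 4 * k%:R / (2 * s)%:R)) ^+ (2 * s) ->
  root4 R #|A| ^+ 3 < psi.
Proof.
move=> A_gt0 big psi0 bound; set n : R := #|A|%:R in big bound *.
have n0 : 0 < n by rewrite ltr0n.
have s2 : (2 * s)%:R != 0 :> R.
  have [s1 [_ _ /andP[s10 s1s] _ _]] := adm.
  by rewrite pnatr_eq0 muln_eq0 /= -lt0n (leq_trans s10).
have e : (psi `^ (4 * k%:R / (2 * s)%:R) * n `^ (1 - 4 * k%:R / (2 * s)%:R)) ^+ (2 * s)
    * n ^+ (4 * k) = psi ^+ (4 * k) * n ^+ (2 * s).
  rewrite exprMn -(powR_mulrn _ (powR_ge0 psi _)) -powRrM divfK //.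
  rewrite -(powR_mulrn _ (powR_ge0 n _)) -powRrM mulrBl divfK // mul1r.
  rewrite -natrM powR_mulrn ?(ltW psi0) // -mulrA; congr (_ * _).
  rewrite -[n ^+ (4 * k)]powR_mulrn ?(ltW n0) // -powRD ?(gt_eqF n0) ?implybT //.
  by rewrite subrK powR_mulrn // ltW.
have h : n ^+ (2 * s) * n ^+ (3 * k) < psi ^+ (4 * k) * n ^+ (2 * s).
  apply: lt_le_trans (_ : mul_E (ind R A) * n ^+ k * n ^+ (3 * k) <= _).
    by rewrite ltr_pM2r ?exprn_gt0.
  by rewrite -mulrA -exprD -mulSn -e ler_wpM2r // exprn_ge0 // ltW.
rewrite mulrC ltr_pM2r ?exprn_gt0 // !exprM in h.
rewrite ltr_pXn2r ?nnegrE ?exprn_ge0 ?(ltW n0) ?(ltW psi0) // in h.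
rewrite -(@ltr_pXn2r _ 4) ?nnegrE ?exprn_ge0 ?root4_ge0 ?(ltW psi0) //.
by rewrite -exprM mulnC exprM root4K.
Qed.

(** Let n = #|A| and take the least [D] with 2 n <= H^D psi. The error H^{-D} n is then at most psi
    / 2, so #|A'| >= psi / 2. Minimality bounds H^D by 2 n H / psi, which with psi > n^{3/4} makes
    the cost of [query_energy] affordable. *)
Lemma extract_additively_small (A : {set T}) : (0 < #|A|)%N ->
  #|A|%:R ^+ (2 * s) < mul_E (ind R A) * #|A|%:R ^+ k ->
  exists2 A' : {set T}, A' \subset A & (0 < #|A'|)%N /\
    add_E (ind R A') <= (Num.sqrt (8 * H) * #|A'|%:R / root4 R #|A|) ^+ (2 * t).
Proof.
move=> A_gt0 big.
have H0 : 0 < H :> R by apply: lt_le_trans H_ge4.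
have H1 : 1 <= H :> R by apply: le_trans H_ge4; rewrite ler1n.
have kap0 : 0 < 4 * k%:R :> R by rewrite mulr_gt0 // ltr0n.
have [|psi [psi_le psi_gt tree bound]] := @tree_bound_exists R T num M num_inj
    num_neq0 num_lt _ _ s kap0 H1 adm M A (leqnn M).
  by move=> i; rewrite leqNgt ltn_ord.
have {psi_gt} psi0 := psi_gt A_gt0; have {psi_le} /andP[_ psi_le] := psi_le.
have psi3 := large_mul_energy_psi A_gt0 big psi0 bound.
set x := root4 R #|A| in psi3 *; set n : R := #|A|%:R in psi_le tree *.
have x0 : 0 < x by apply: root4_gt0.
have x4 : x ^+ 4 = n by apply: root4K.
have n0 : 0 < n by rewrite ltr0n.
have psi1 : 1 <= psi.
  apply: le_trans (ltW psi3); rewrite exprn_ege1 //.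
  rewrite -(@ler_pXn2r _ 4) ?nnegrE ?(ltW x0) // expr1n x4.
  by rewrite ler1n.
have exD : exists D, 2 * n <= H ^+ D * psi.
  exists (2 * #|A|)%N; apply: le_trans (_ : H ^+ (2 * #|A|) * 1 <= _); last first.
    by rewrite ler_wpM2l // exprn_ge0 // ltW.
  rewrite mulr1; apply: le_trans (_ : 2 ^+ (2 * #|A|) <= _).
    by rewrite /n -natrM -natrX ler_nat ltnW // ltn_expl.
  apply: lerXn2r; rewrite ?nnegrE ?(ltW H0) //.
  by apply: le_trans H_ge4; rewrite ler_nat.
case: (ex_minnP exD) => D hD minD.
have D_gt0 : (0 < D)%N.
  rewrite lt0n; apply/eqP => D0; move: hD; rewrite D0 expr0 mul1r; lra.
have hD' : H ^+ D * psi <= 2 * n * H.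
  rewrite -(prednK D_gt0) exprS mulrC mulrCA mulrC ler_wpM2r ?(ltW H0) //.
  rewrite mulrC leNgt; apply/negP => /ltW/minD.
  by rewrite -ltnS prednK // ltnn.
have [A' sA' [qA' hA']] := tree D.
have HD : 0 < H ^+ D :> R by rewrite exprn_gt0.
have half : H ^- D * n <= psi / 2.
  by rewrite mulrC ler_pdivrMr // mulrAC ler_pdivlMr // mulrC [psi * _]mulrC.
have A'psi : psi <= 2 * #|A'|%:R by lra.
exists A' => //; split; first by rewrite -(ltr0n R); lra.
apply: le_trans (query_energy R num_neq0 t_gt0 qA') _.
set m : R := #|A'|%:R in A'psi *; have m0 : 0 < m by lra.
have m2 : 0 <= 2 * m by rewrite mulr_ge0 // ltW.
have a1 : 0 <= H ^+ D * (2 * m) by rewrite mulr_ge0 // ltW.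
rewrite exprM; apply: lerXn2r; rewrite ?nnegrE ?sqr_ge0 //.
have H8 : 0 <= 8 * H :> R by rewrite mulr_ge0 // ltW.
rewrite [leRHS]exprMn [(_ * m) ^+ 2]exprMn exprVn sqr_sqrtr //.
rewrite ler_pdivlMr ?exprn_gt0 //.
have g1 : H ^+ D * psi * x ^+ 2 <= 2 * n * H * x ^+ 2.
  by rewrite ler_wpM2r // exprn_ge0 // ltW.
have g2 : 2 * n * H * x ^+ 2 = 2 * H * (x ^+ 3) ^+ 2 by rewrite -x4; ring.
have g3 : (x ^+ 3) ^+ 2 <= psi * (2 * m).
  rewrite expr2; apply: ler_pM => //; rewrite ?exprn_ge0 ?(ltW x0) ?(ltW psi3) //.
  by apply: le_trans (ltW psi3) _.
have g4 : H ^+ D * x ^+ 2 <= 4 * H * m.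
  rewrite -(ler_pM2r psi0).
  have : 2 * H * (x ^+ 3) ^+ 2 <= 2 * H * (psi * (2 * m)).
    by rewrite ler_wpM2l // mulr_ge0 // ltW.
  lra.
have : (H ^+ D * x ^+ 2) * (2 * m) <= 4 * H * m * (2 * m).
  by rewrite ler_wpM2r // mulr_ge0 // ltW.
by rewrite expr2; lra.
Qed.

(** The factor 4/3 inverts the 3/4 of the telescoping inequality. *)
Let K : R := 4 / 3 * Num.sqrt (8 * H).

(** Strong induction on #|A|. If the multiplicative energy is already small, take C = A. Otherwise
    remove [A'], decompose the rest and add [A'] to its additive part. *)
Lemma set_decomposition (A : {set T}) : exists B C : {set T},
  [/\ [disjoint B & C], B :|: C = A,
      add_E (ind R B) <= (K * root4 R #|B| ^+ 3) ^+ (2 * t)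
    & mul_E (ind R C) * #|C|%:R ^+ k <= #|C|%:R ^+ (2 * s)].
Proof.
have K0 : 0 <= K by rewrite mulr_ge0 ?sqrtr_ge0 // divr_ge0.
have [n] := ubnP #|A|; elim: n A => // n IH A; rewrite ltnS => An.
have [small|big] := leP (mul_E (ind R A) * #|A|%:R ^+ k) (#|A|%:R ^+ (2 * s)).
  exists finset.set0, A; split=> //; first by rewrite -finset.setI_eq0 finset.set0I.
    by rewrite finset.set0U.
  apply: le_trans (energy_le_total _ _ (@ind_ge0 R T finset.set0)) _.
  rewrite sum_ind cards0 expr0n muln_eq0 (gtn_eqF t_gt0) /=.
  by rewrite exprn_ge0 // mulr_ge0 // exprn_ge0 // root4_ge0.
have A_gt0 : (0 < #|A|)%N.
  rewrite lt0n; apply/eqP => A0; move: big; rewrite A0.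
  by rewrite [_ ^+ k]expr0n (gtn_eqF k_gt0) mulr0 ltNge exprn_ge0.
have [A' sA' [A'_gt0 eA']] := extract_additively_small A_gt0 big.
have cA : (#|A| = #|A'| + #|A :\: A'|)%N.
  by rewrite -(cardsID A' A) (finset.setIidPr sA').
have [|B' [C [dBC BC eB eC]]] := IH (A :\: A'); first by lia.
have dA'B : [disjoint A' & B'].
  rewrite disjoint_sym; apply: disjointWl (_ : B' \subset A :\: A') _.
    by rewrite -BC finset.subsetUl.
  by rewrite -finset.setI_eq0 finset.setIDAC -finset.setIDA finset.setDv finset.setI0.
have sB'A : A' :|: B' \subset A.
  rewrite finset.subUset sA'; apply: fintype.subset_trans (finset.subsetDl A A').
  by rewrite -BC finset.subsetUl.
have cB : (#|A' :|: B'| = #|A'| + #|B'|)%N.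
  by apply/eqP; rewrite (leq_card_setU A' B').2.
exists (A' :|: B'), C; split=> //.
- rewrite -finset.setI_eq0 finset.setIUl finset.setU_eq0 !finset.setI_eq0 dBC andbT.
  rewrite disjoint_sym; apply: disjointWl (_ : C \subset A :\: A') _.
    by rewrite -BC finset.subsetUr.
  by rewrite -finset.setI_eq0 finset.setIDAC -finset.setIDA finset.setDv finset.setI0.
- by rewrite -finset.setUA BC -{1}(finset.setIidPr sA') finset.setID.
have q0 : 0 <= Num.sqrt (8 * H) * #|A'|%:R / root4 R #|A|.
  by rewrite divr_ge0 ?mulr_ge0 ?sqrtr_ge0 ?root4_ge0.
have r0 : 0 <= K * root4 R #|B'| ^+ 3 by rewrite mulr_ge0 ?exprn_ge0 ?root4_ge0.
apply: le_trans (energy_union t_gt0 dA'B q0 r0 eA' eB) _.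
apply: lerXn2r; rewrite ?nnegrE.
- exact: addr_ge0.
- by rewrite mulr_ge0 ?exprn_ge0 ?root4_ge0.
set x := root4 R #|A|; set y := root4 R #|A' :|: B'|; set z := root4 R #|B'|.
have y0 : 0 < y by apply: root4_gt0; rewrite cB addn_gt0 A'_gt0.
have yx : y <= x by apply: root4_le; apply: subset_leq_card.
have e : #|A'|%:R = y ^+ 4 - z ^+ 4 by rewrite !root4K cB natrD addrK.
have h : #|A'|%:R / x <= #|A'|%:R / y.
  by rewrite ler_wpM2l // lef_pV2 // posrE // (lt_le_trans y0).
(* As #|A'| = y^4 - z^4, the norm added by [A'] is paid for by the growth of #|B|^{3/4}. Since B
   lies in A, [y] may replace [x] in the denominator. *)
have h2 : 3 / 4 * (#|A'|%:R / y) <= y ^+ 3 - z ^+ 3.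
  rewrite mulrA ler_pdivrMr // e.
  have := young4 y z; rewrite !exprS expr0; lra.
have -> : Num.sqrt (8 * H) = 3 / 4 * K by rewrite /K; field.
have := ler_wpM2l K0 h2; have := ler_wpM2l K0 h.
lra.
Qed.
End Decomposition.

(** * Passing to finite sets of integers *)

Lemma energy_ind (R : realDomainType) (T I : finType) (phi : T -> I -> int) t
    (S : {set T}) :
  energy phi t (ind R S) =
  #|[set p : {ffun slot t -> T} | balanced phi p & [forall k, p k \in S]]|%:R.
Proof.
rewrite -sum1_card natr_sum /energy /wsum big_mkcond [RHS]big_mkcond /=.
apply: eq_bigr => p _; rewrite inE; case: (balanced phi p) => //=.
case: ifPn => [/forallP pS|]; first by rewrite big1 // => k _; rewrite /ind pS.
rewrite negb_forall => /existsP[k /negPf pk].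
by rewrite (bigD1 k) //= /ind pk mul0r.
Qed.

(** Choosing a preimage of each entry lifts every balanced tuple of the image. *)
Lemma energy_image (R : realDomainType) (T1 T2 I : finType) (phi1 : T1 -> I -> int)
    (phi2 : T2 -> I -> int) t (h : T2 -> T1) (S : {set T2}) :
  (forall a i, phi1 (h a) i = phi2 a i) ->
  energy phi1 t (ind R (h @: S)) <= energy phi2 t (ind R S).
Proof.
move=> hphi; rewrite !energy_ind ler_nat.
set D1 := [set p | _ & _]; set D2 := [set p | _ & _].
suff sD : D1 \subset (fun p : {ffun slot t -> T2} => [ffun k => h (p k)]) @: D2.
  exact: leq_trans (subset_leq_card sD) (leq_imset_card _ _).
apply/fintype.subsetP => p; rewrite inE => /andP[/forallP bal /forallP pS].
have /choice[f fP] : forall k, exists a, a \in S /\ p k = h a.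
  by move=> k; have /imsetP[a aS ->] := pS k; exists a.
have pE k : p k = h (f k) by have [] := fP k.
apply/imsetP; exists [ffun k => f k].
  rewrite inE; apply/andP; split; apply/forallP => k.
    have := bal k; congr (_ == _); apply: eq_bigr => j _.
    by rewrite ffunE pE hphi.
  by rewrite ffunE; have [] := fP k.
by apply/ffunP => k; rewrite !ffunE pE.
Qed.

Lemma card_solutions_le (R : realDomainType) (X T I : finType) (phi : T -> I -> int)
    t (S : {set T}) (g : X -> T) (P : pred ({ffun 'I_t -> X} * {ffun 'I_t -> X})) :
  injective g -> (forall x, g x \in S) ->
  (forall p i, P p -> \sum_j phi (g (p.1 j)) i = \sum_j phi (g (p.2 j)) i) ->
  #|[set p | P p]|%:R <= energy phi t (ind R S).
Proof.
move=> g_inj gS Pphi; rewrite energy_ind ler_nat.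
pose F (p : {ffun 'I_t -> X} * {ffun 'I_t -> X}) : {ffun slot t -> T} :=
  [ffun k => g (if k.1 then p.1 k.2 else p.2 k.2)].
have F_inj : injective F.
  move=> [p1 p2] [q1 q2] /ffunP e; congr pair; apply/ffunP => j.
    by have := e (true, j); rewrite !ffunE /= => /g_inj.
  by have := e (false, j); rewrite !ffunE /= => /g_inj.
rewrite -(card_imset _ F_inj); apply/subset_leq_card/fintype.subsetP => _ /imsetP[p + ->].
rewrite !inE => Pp; apply/andP; split; apply/forallP => i; last by rewrite ffunE.
apply/eqP.
transitivity (\sum_b \sum_j slot_sign b * phi (F p (b, j)) i).
  by rewrite pair_bigA; apply: eq_bigr => -[].
rewrite big_bool /= /slot_sign.
under eq_bigr do rewrite mul1r ffunE /=.
under [X in _ + X]eq_bigr do rewrite mulN1r ffunE /=.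
by rewrite sumrN (Pphi p) // subrr.
Qed.

Section Transfer.
Variables (R : realDomainType) (T : finType) (num : T -> int) (X : {fset int}).
Variable S : {set T}.
Hypothesis XS : forall x, x \in X -> exists2 a, a \in S & num a = x.

Let section : exists g : X -> T, [/\ injective g, forall x, g x \in S &
  forall x, num (g x) = fsval x].
Proof.
have /choice[g gP] : forall x : X, exists a, a \in S /\ num a = fsval x.
  by move=> x; have [a aS ax] := XS (fsvalP x); exists a.
exists g; split=> [x y e|x|x]; try by have [] := gP x.
by apply: val_inj; have [_ /= <-] := gP x; have [_ /= <-] := gP y; rewrite e.
Qed.

Lemma add_energy_le t :
  (add_energy t X)%:R <= energy (fun a (_ : unit) => num a) t (ind R S).
Proof.
have [g [g_inj gS gE]] := section.
apply: (card_solutions_le (phi := fun a (_ : unit) => num a) R g_inj gS) => p i /eqP e.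
under eq_bigr do rewrite gE.
by under [RHS]eq_bigr do rewrite gE.
Qed.

(** Equal products have equal valuations at every prime. The converse fails because signs are lost,
    hence an inequality. *)
Lemma mul_energy_le t M : (forall a, num a != 0) ->
  (mul_energy t X)%:R <= energy (@valuation T num M) t (ind R S).
Proof.
move=> num_neq0; have [g [g_inj gS gE]] := section.
apply: (card_solutions_le (phi := @valuation T num M) R g_inj gS) => p i /eqP e.
pose Q (f : {ffun 'I_t -> X}) : int := \prod_j fsval (f j).
have logP (f : {ffun 'I_t -> X}) : \sum_j valuation num (g (f j)) i = (logn i `|Q f|)%:Z.
  suff [_ ->] : (0 < `|Q f|)%N /\
    (logn i `|Q f|)%:Z = \sum_j valuation num (g (f j)) i by [].
  rewrite /Q; elim/big_ind2: _ => [|x u y v [x0 <-] [y0 <-]|j _].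
  - by rewrite logn1.
  - by rewrite abszM lognM // muln_gt0 x0 y0.
  - by rewrite /valuation gE -gE absz_gt0.
by rewrite !logP /Q e.
Qed.
End Transfer.

Lemma natr_absz_ceil (R : realType) (x : R) : 0 <= x ->
  x <= `|Num.ceil x|%N%:R < x + 1.
Proof.
move=> x0; have c0 : 0 <= Num.ceil x by rewrite ceil_ge0 (lt_le_trans _ x0) // ltrN10.
have -> : `|Num.ceil x|%N%:R = (Num.ceil x)%:~R :> R.
  by rewrite -[in RHS](gez0_abs c0).
have := ceil_itv x; rewrite intrB; lra.
Qed.

(** Let K be the ceiling of k. From Lambda >= 6 and K <= 2k, the inner exponent is at least 24 q K,
    and (100 X)^3 <= (2^{7+X})^3 <= 2^{24 X} for X = q K >= 1. *)
Lemma exponent_large (R : realType) (k : R) (q l : nat) : 1 <= k -> (2 <= q)%N ->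
  ((100 * (q * `|Num.ceil k|%N)) ^ 3 <=
   5 + (1 + 120 * 2 ^ `|Num.ceil (600 * q%:R * k * (6 + 25 * ln (q%:R : R)))|%N)
       * (l + 1))%N.
Proof.
move=> k1 q2; set K := `|Num.ceil k|%N; set c := `|Num.ceil (600 * _ * _ * _)|%N.
have q1 : 1 <= q%:R :> R by rewrite ler1n; apply: leq_trans q2.
have lnq : 0 <= ln (q%:R : R) by apply: ln_ge0.
have /andP[_ Kk] : k <= K%:R < k + 1 by apply: natr_absz_ceil; lra.
have qk : 0 <= q%:R * k by apply: mulr_ge0; lra.
have lo : q%:R * k * 6 <= q%:R * k * (6 + 25 * ln (q%:R : R)).
  by rewrite ler_wpM2l //; lra.
have c_ge : (24 * (q * K) <= c)%N.
  have /andP[cl _] := @natr_absz_ceil R (600 * q%:R * k * (6 + 25 * ln (q%:R : R)))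
    ltac:(lra).
  rewrite -(ler_nat R) natrM natrM; apply: le_trans cl.
  have : q%:R * K%:R <= q%:R * (2 * k) by rewrite ler_wpM2l //; lra.
  lra.
have h : ((100 * (q * K)) ^ 3 <= 2 ^ c)%N.
  apply: (@leq_trans (2 ^ (24 * (q * K)))); last by rewrite leq_pexp2l.
  have [->|X0] := posnP (q * K); first by rewrite muln0.
  rewrite (_ : (24 * (q * K) = 8 * (q * K) * 3)%N); last by rewrite mulnAC.
  rewrite expnM leq_exp2r //; apply: (@leq_trans (2 ^ 7 * 2 ^ (q * K))).
    by apply: leq_mul => //; apply: ltnW; apply: ltn_expl.
  rewrite -expnD leq_pexp2l // (_ : (8 * (q * K) = 7 * (q * K) + q * K)%N).
    by rewrite leq_add2r leq_pmulr.
  by rewrite -mulSnr.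
apply: leq_trans h _; apply: leq_trans (leq_addl 5 _).
apply: leq_trans (_ : (1 + 120 * 2 ^ c) * 1 <= _)%N.
  rewrite muln1; apply: leq_trans (leq_addl 1 _).
  by rewrite leq_pmull.
by rewrite leq_mul2l addn1 orbT.
Qed.

(** Zero has no valuations, so it is adjoined afterwards as [None]. A singleton has norm at most 1,
    and the triangle inequality adds it. *)
Lemma add_energy_adjoin0 (R : realType) (T : finType) (num : T -> int) (t : nat)
    (S : {set T}) (X : {fset int}) (z : bool) (N : R) : (0 < t)%N -> 0 <= N ->
  (forall x, x \in X -> (z && (x == 0)) || [exists a in S, num a == x]) ->
  energy (fun a (_ : unit) => num a) t (ind R S) <= N ^+ (2 * t) ->
  (add_energy t X)%:R <= (N + z%:R) ^+ (2 * t).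
Proof.
move=> t0 N0 XS eS.
pose num' (o : option T) : int := if o is Some a then num a else 0.
pose Z : {set option T} := if z then [set None] else finset.set0.
have NZ : [disjoint Some @: S & Z].
  rewrite disjoint_sym finset.disjoints_subset; apply/fintype.subsetP => o.
  rewrite /Z; case: ifP => _; rewrite !inE // => /eqP ->.
  by apply/imsetP => -[].
have z0 : 0 <= z%:R :> R by [].
apply: le_trans (energy_union (phi := fun o (_ : unit) => num' o) t0 NZ N0 z0 _ _).
- apply: add_energy_le => x /XS /orP[/andP[zT /eqP ->]|/existsP[a /andP[aS /eqP <-]]].
    by exists None => //; rewrite !inE /Z zT inE eqxx orbT.
  by exists (Some a) => //; rewrite inE imset_f.
- by apply: le_trans eS; apply: energy_image.
- apply: le_trans (energy_le_total _ _ (@ind_ge0 R _ Z)) _.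
  by rewrite sum_ind /Z; case: (z); rewrite ?cards1 ?cards0.
Qed.

Local Open Scope fset_scope.
Local Open Scope ring_scope.

Lemma mul_energy_empty t (X : {fset int}) : (0 < t)%N -> #|` X| = 0%N ->
  mul_energy t X = 0%N.
Proof.
move=> t0 X0; apply: eq_card0 => p; exfalso.
have : (0 < #|` X|)%N; last by rewrite X0.
by rewrite cardfs_gt0; apply/fset0Pn; exists (fsval (p.1 (Ordinal t0))); apply: fsvalP.
Qed.

(** For n >= 1 this is 3/4 <= 4/5 in the exponents; for n = 0 both sides vanish. *)
Lemma root4_pow_le (R : realType) (n q : nat) : (0 < q)%N ->
  (root4 R n ^+ 3) ^+ q <= n%:R `^ (q%:R - q%:R / 5).
Proof.
move=> q_gt0; have q0 : 0 < q%:R :> R by rewrite ltr0n.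
rewrite -exprM -powR_mulrn ?root4_ge0 // -powRrM natrM.
have [->|n0] := posnP n; last by rewrite ler_powR ?ler1n //; lra.
have e1 : 1 / 4 * (3 * q%:R) != 0 :> R by rewrite gt_eqF //; lra.
have e2 : q%:R - q%:R / 5 != 0 :> R by rewrite gt_eqF //; lra.
by rewrite !powR0.
Qed.

Lemma fset_decomposition (R : realType) (k s t : nat) (A : {fset int}) :
  (0 < k)%N -> (0 < t)%N -> admissible (4 * k%:R : R) ((2 * t)%:R ^+ 2) s ->
  exists B C : {fset int}, [/\ [disjoint B & C], A = B `|` C,
    (add_energy t B)%:R <=
      ((4 / 3 * Num.sqrt (8 * (2 * t)%:R ^+ 2) + 1) * root4 R #|` B| ^+ 3) ^+ (2 * t)
  & (mul_energy s C)%:R * #|` C|%:R ^+ k <= #|` C|%:R ^+ (2 * s) :> R].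
Proof.
move=> k0 t0 adm; set K := 4 / 3 * _.
have K0 : 0 <= K by rewrite mulr_ge0 ?sqrtr_ge0 // divr_ge0.
pose T : finType := A `\ (0 : int).
pose num (a : T) : int := fsval a.
pose M := (\max_(a : T) `|num a|%N).+1.
have num_inj : injective num by apply: val_inj.
have num_neq0 a : num a != 0 by have := fsvalP a; rewrite !inE => /andP[].
have num_lt a : (`|num a| < M)%N by rewrite ltnS (leq_bigmax a).
have [B0 [C0 [dBC BC eB eC]]] :=
  @set_decomposition R T num M num_inj num_neq0 num_lt k s t k0 t0 adm [set: T].
(* Defining [B] as the complement of [C] in [A] places 0, if present, in [B]. *)
pose C := [fset x in A | [exists a in C0, num a == x]].
pose B := A `\` C.
have numA a : num a \in A by have := fsvalP a; rewrite !inE => /andP[].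
have memC x : (x \in C) = [exists a in C0, num a == x].
  rewrite !inE andb_idl // => /existsP[a /andP[_ /eqP <-]]; exact: numA.
have memB x : x \in B -> ((0 \in A) && (x == 0)) || [exists a in B0, num a == x].
  rewrite in_fsetD memC => /andP[nC xA].
  have [x0|x0] := eqVneq x 0; first by rewrite -x0 xA.
  have xT : x \in A `\ (0 : int) by rewrite !inE x0.
  rewrite andbF /=; apply/existsP; exists [` xT]; rewrite /num /= eqxx andbT.
  have : [` xT] \in B0 :|: C0 by rewrite BC inE.
  rewrite inE => /orP[//|aC]; case/negP: nC; apply/existsP; exists [` xT].
  by rewrite aC /num /=.
(* The cardinality of [C] occurs on both sides of its bound, so equality is required; for [B] it
   occurs only on the right, and an inequality suffices. *)
have cardC : #|` C| = #|C0|.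
  rewrite [RHS]cardE -[RHS](size_map num); apply/perm_size/uniq_perm.
  - exact: fset_uniq.
  - by rewrite map_inj_uniq // enum_uniq.
  - move=> x; rewrite memC; apply/existsP/mapP => [[a /andP[aC /eqP <-]]|[a]].
      by exists a; rewrite ?mem_enum.
    by rewrite mem_enum => aC ->; exists a; rewrite aC eqxx.
have cardB : (#|B0| <= #|` B|)%N.
  rewrite cardE -[leqLHS](size_map num); apply: uniq_leq_size.
    by rewrite map_inj_uniq // enum_uniq.
  move=> x /mapP[a]; rewrite mem_enum => aB ->; rewrite in_fsetD numA andbT memC.
  apply/negP => /existsP[b /andP[bC /eqP/num_inj ba]].
  by have := disjointFr dBC aB; rewrite -ba bC.
exists B, C; split.
- by apply/fdisjointP => x; rewrite in_fsetD => /andP[].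
- apply/fsetP => x; rewrite in_fsetU in_fsetD; have [xC|_] := boolP (x \in C); last by rewrite orbF.
  by move: xC; rewrite memC => /existsP[a /andP[_ /eqP <-]]; rewrite numA.
- have r0 : 0 <= K * root4 R #|B0| ^+ 3 by rewrite mulr_ge0 ?exprn_ge0 ?root4_ge0.
  apply: le_trans (add_energy_adjoin0 t0 r0 memB eB) _.
  apply: lerXn2r; rewrite ?nnegrE ?addr_ge0 //.
    by rewrite mulr_ge0 ?exprn_ge0 ?root4_ge0 ?addr_ge0.
  rewrite mulrDl mul1r; apply: lerD.
    by rewrite ler_wpM2l // lerXn2r ?nnegrE ?root4_ge0 // root4_le.
  have [A0|_] := boolP (0 \in A); last by rewrite exprn_ge0 ?root4_ge0.
  have zB : 0 \in B.
    rewrite in_fsetD A0 andbT memC; apply/existsP => -[a /andP[_ h]].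
    by have := num_neq0 a; rewrite h.
  (* When 0 lies in [B], the set is non-empty, so the extra 1 is absorbed by raising the constant
     from [K] to [K + 1]. *)
  have B1 : 1 <= root4 R #|` B|.
    have -> : 1 = root4 R 1 by rewrite /root4 powR1.
    by apply: root4_le; rewrite cardfs_gt0; apply/fset0Pn; exists 0.
  by rewrite exprn_ege1.
- rewrite cardC; apply: le_trans eC; rewrite ler_wpM2r ?exprn_ge0 //.
  apply: mul_energy_le => // x; rewrite memC => /existsP[a /andP[aC /eqP <-]].
  by exists a.
Qed.

Theorem theorem1p2 (R : realType) :
  exists Cs : nat -> R,
  forall (k : R) (q : nat), 1 <= k -> ~~ odd q -> (2 <= q)%N ->
  let Lam : R := 6 + 25 * ln (q%:R : R) in
  let s : nat := (2 ^ (5 + (1 + 120 * 2 ^ `|Num.ceil (600 * q%:R * k * Lam)|%N)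
                          * (`|Num.ceil (ln k)|%N + 1)))%N in
  exists C1 : R,
  forall A : {fset int}, A != fset0 ->
  exists B C : {fset int},
    [disjoint B & C] /\ A = B `|` C /\
    (add_energy (q./2) B)%:R <= C1 * (#|` B|%:R : R) `^ (q%:R - q%:R / 5) /\
    (mul_energy s C)%:R <= Cs s * (#|` C|%:R : R) `^ (2 * s%:R - k).
Proof.
(* The multiplicative bound holds with constant 1; it is proved for the integer ceiling of [k], a
   stronger saving as soon as [C] is non-empty. *)
exists (fun=> 1) => k q k1 q_even q2 Lam s.
have adm : admissible (4 * `|Num.ceil k|%N%:R : R) (q%:R ^+ 2) s.
  apply: admissible_large => //; last exact: exponent_large.
  by rewrite absz_gt0 gt_eqF // ceil_gt0 (lt_le_trans ltr01).
have /andP[k_ceil _] := @natr_absz_ceil R k (le_trans ler01 k1).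
set K := `|Num.ceil k|%N in adm k_ceil.
have K0 : (0 < K)%N by rewrite -(ltr0n R); apply: lt_le_trans k_ceil; apply: lt_le_trans k1.
have qE : q = (2 * q./2)%N by rewrite mul2n even_halfK.
have t0 : (0 < q./2)%N by rewrite -(ltn_pmul2l (ltn0Sn 1)) -qE muln0 ltnW.
set c : R := 4 / 3 * Num.sqrt (8 * q%:R ^+ 2) + 1.
have c0 : 0 <= c by rewrite addr_ge0 // mulr_ge0 ?sqrtr_ge0 // divr_ge0.
exists (c ^+ q) => A _.
have [|B [C [dBC AE eB eC]]] := @fset_decomposition R K s q./2 A K0 t0.
  by rewrite -qE.
exists B, C; split=> //; split=> //; rewrite -qE -/c in eB; split.
- apply: le_trans eB _; rewrite exprMn ler_wpM2l ?exprn_ge0 //.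
  by apply: root4_pow_le; apply: ltnW.
- rewrite mul1r; have [C0|C_gt0] := posnP #|` C|.
    by rewrite mul_energy_empty ?powR_ge0 // expn_gt0.
  have n1 : 1 <= #|` C|%:R :> R by rewrite ler1n.
  have n0 : 0 < #|` C|%:R :> R by apply: lt_le_trans n1.
  rewrite -(ler_pM2r (exprn_gt0 K n0)); apply: le_trans eC _.
  rewrite -!powR_mulrn ?(ltW n0) // -powRD; last by rewrite (gt_eqF n0) implybT.
  by rewrite ler_powR // natrM -addrA lerDl addrC subr_ge0.
Qed.
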